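(* In the infinite-horizon discounted coordinator problem (P$_\infty$) described in the context, with discount factor $\delta\in(0,1)$, it is without loss of optimality for the coordinator to restrict attention to stationary summary-based strategies, i.e. $\tilde\phi$ with $\tilde\phi_t=\tilde\phi_0$ for all $t$, where $$\tilde\phi_0:\Delta(\mathbb Z)\to\big(\mathbb Z\times\mathcal M\to\Delta(\mathcal A)\big),$$ used through $\phi_t[a^{t-1}](\cdot\mid m^t)=\tilde\phi_0[\eta_t](\cdot\mid n(m^{t-1}),m_t)$. That is, there is such a strategy $\tilde\phi_0^*$ whose induced policy is optimal for (P$_\infty$). Furthermore, the optimal strategy $\tilde\phi_0^*$ satisfies the Bellman equation, with $\tilde V:\Delta(\mathbb Z)\to\mathbb R$ bounded: for all $\eta\in\Delta(\mathbb Z)$, $$\tilde V(\eta)=\max_{\tilde\theta\in\tilde S(\eta)}\Big\{\tilde f^x(\eta,\tilde\theta)+\delta\,\mathbb E\big[\tilde V(\eta_{t+1})\mid\eta_t=\eta,\tilde\theta_t=\tilde\theta\big]\Big\},$$ $$\tilde\phi_0^*[\eta]\in\arg\max_{\tilde\theta\in\tilde S(\eta)}\Big\{\tilde f^x(\eta,\tilde\theta)+\delta\,\mathbb E\big[\tilde V(\eta_{t+1})\mid\eta_t=\eta,\tilde\theta_t=\tilde\theta\big]\Big\}.$$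
   Context: Model. Let $p\in(0,1/2)$, $\bar p=1-p$, $\mathcal W=\mathcal Y=\mathcal M=\mathcal A=\{-1,1\}$. $W$ is uniform on $\mathcal W$; given $W=w$, the signals $Y_1,Y_2,\dots$ are i.i.d. with $Q^y(y\mid w)=\bar p$ if $y=w$ and $p$ if $y\ne w$. $\Delta(S)$ denotes the set of probability distributions on $S$; $x^t=(x_1,\dots,x_t)$. For integer $n$ put $q(1\mid n)=\frac{(\bar p/p)^n}{(\bar p/p)^n+1}$, $q(-1\mid n)=\frac{1}{(\bar p/p)^n+1}$, and $n(m^{t-1})=\sum_{\tau=1}^{t-1}m_\tau$ (equal to $0$ for $t=1$). Policies. A partial strategy at time $t$ is a map $\theta_t:\mathcal M^t\to\Delta(\mathcal A)$. A policy is $\phi=(\phi_t)_{t\ge1}$, where $\phi_t$ maps each public action history $a^{t-1}\in\mathcal A^{t-1}$ to a partial strategy $\theta_t=\phi_t[a^{t-1}]$. All agents join the mechanism and report truthfully, $M_t=Y_t$ (agent $t$'s message, seen only by the coordinator); the publicly observed action satisfies $A_t\sim\theta_t(\cdot\mid M^t)$. Public belief. $\pi_1$ is the trivial distribution on the one-point set $\mathcal M^0$, and $\pi_{t+1}=T_t(\pi_t,a_t,\theta_t)$ with $$\pi_{t+1}(m^t)=\frac{\sum_w q(w\mid n(m^{t-1}))\,\pi_t(m^{t-1})\,Q^y(m_t\mid w)\,\theta_t(a_t\mid m^t)}{\sum_{\bar w,\bar m^t} q(\bar w\mid n(\bar m^{t-1}))\,\pi_t(\bar m^{t-1})\,Q^y(\bar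 m_t\mid\bar w)\,\theta_t(a_t\mid\bar m^t)}$$ (when the denominator vanishes, $a_t$ has probability $0$ and any fixed convention may be used). The induced summary belief is $\eta_t\in\Delta(\mathbb Z)$, $\eta_t(n)=\sum_{m^{t-1}:\,n(m^{t-1})=n}\pi_t(m^{t-1})$. Truth-telling. $S_t(\pi)$ is the set of partial strategies $\theta$ such that for both $y\in\{-1,1\}$, $\sum_{w,m^{t-1}}Q^y(y\mid w)q(w\mid n(m^{t-1}))\pi(m^{t-1})\big(\theta(w\mid(m^{t-1},y))-\theta(w\mid(m^{t-1},-y))\big)\ge0$. Tax. $\hat f^x_t(\pi,\theta)=\sum_{y,w,m^{t-1}}Q^y(y\mid w)q(w\mid n(m^{t-1}))\pi(m^{t-1})\big(\theta(w\mid(m^{t-1},y))-\gamma_\pi(w\mid y)\big)$, where $\gamma_\pi(\cdot\mid y)$ is supported on the maximizers over $a\in\mathcal A$ of $Q^y(y\mid a)\sum_{m^{t-1}}q(a\mid n(m^{t-1}))\pi(m^{t-1})$ (the tax does not depend on tie-breaking). Problem (P$_\infty$). Maximize $\mathbb E^\phi\big[\sum_{t=1}^\infty\delta^{t-1}\hat f^x_t(\pi_t,\theta_t)\big]$ over policies $\phi$ with $\phi_t[a^{t-1}]\in S_t(\pi_t)$ for all $t$ and $a^{t-1}$. Summary-based objects. For $\eta\in\Delta(\mathbb Z)$ and $\tilde\theta:\mathbb Z\times\mathcal M\to\Delta(\mathcal A)$: $\tilde S(\eta)=\{\tilde\theta:\sum_{w,n}Q^y(y\mid w)\eta(n)q(w\mid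 n)(\tilde\theta(w\mid n,y)-\tilde\theta(w\mid n,-y))\ge0\ \ \forall y\}$; $\tilde f^x(\eta,\tilde\theta)=\sum_{y,w,n}Q^y(y\mid w)\eta(n)q(w\mid n)(\tilde\theta(w\mid n,y)-\gamma_\eta(w\mid y))$, with $\gamma_\eta(\cdot\mid y)$ supported on the maximizers over $a$ of $Q^y(y\mid a)\sum_n\eta(n)q(a\mid n)$. Given $\eta_t=\eta$ and $\tilde\theta_t=\tilde\theta$, action $a_t=a$ occurs with probability $\sum_{w,n,m}\eta(n)q(w\mid n)Q^y(m\mid w)\tilde\theta(a\mid n,m)$ and then $\eta_{t+1}=\tilde T(\eta,a,\tilde\theta)$, where $$\tilde T(\eta,a,\tilde\theta)(n')=\frac{\sum_{w}\sum_{m\in\{-1,1\}}\eta(n'-m)\,q(w\mid n'-m)\,Q^y(m\mid w)\,\tilde\theta(a\mid n'-m,m)}{\sum_{w,n,m}\eta(n)\,q(w\mid n)\,Q^y(m\mid w)\,\tilde\theta(a\mid n,m)}.$$ *)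

(* Defs.v *)
From HB Require Import structures.
From mathcomp Require Import all_boot all_order all_algebra.
From mathcomp Require Import all_classical all_reals all_analysis.
From mathcomp Require Import ring lra.

Set Implicit Arguments.
Unset Strict Implicit.
Unset Printing Implicit Defensive.
Import Order.TTheory GRing.Theory Num.Theory.
Import numFieldNormedType.Exports.

Local Open Scope classical_set_scope.
Local Open Scope ring_scope.

(* Conventions.
   - W = Y = M = A = {-1, 1} is encoded as [bool]: [true] is 1, [false] is -1,
     and [~~ y] is -y; [pm] is the embedding into the integers.
   - Time starts at 0: index t stands for time t + 1 of the 1-based model, so
     that a [t.-tuple bool] is the history available at index t.
   - Histories are stored most recent entry first: the head of the tuple x^t is
     x_t and its tail is x^(t-1). *)

Section Distributions.
Variable R : realType.

(* The probability distributions on a countable set S. *)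
Record dist (S : choiceType) := Dist {
  mass :> S -> R ;
  mass_ge0 : forall x, 0 <= mass x ;
  mass_sum1 : (\esum_(x in [set: S]) (mass x)%:E = 1)%E }.

(* The sum of an absolutely summable real family (a junk value otherwise). *)
Definition csum (S : choiceType) (f : S -> R) : R :=
  fine (\esum_(x in [set: S]) ((EFin \o f)^\+ x)
        - \esum_(x in [set: S]) ((EFin \o f)^\- x))%E.

Lemma csum_ge0E (S : choiceType) (f : S -> R) : (forall x, 0 <= f x) ->
  csum f = fine (\esum_(x in [set: S]) (f x)%:E)%E.
Proof.
move=> f0; rewrite /csum [X in (_ - X)%E]esum1 ?sube0; last first.
  by move=> x _; rewrite funenegE /= max_r// lee_fin oppr_le0.
by congr fine; apply: eq_esum => x _; rewrite funeposE /= max_l// lee_fin.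
Qed.

Lemma esumZl (S : choiceType) (c : R) (f : S -> R) :
  0 <= c -> (forall x, 0 <= f x) ->
  (\esum_(x in [set: S]) (c * f x)%:E
   = c%:E * \esum_(x in [set: S]) (f x)%:E)%E.
Proof.
move=> c0 f0; rewrite /esum -ereal_supZl//; last first.
  by apply/set0P; exists 0%E, set0; [exact: fsets_set0 | rewrite fsbig_set0].
congr ereal_sup; rewrite image_comp; apply: eq_imagel => A [finA _] /=.
by rewrite ge0_mule_fsumr// => x; rewrite lee_fin.
Qed.

Lemma esum_finType (T : finType) (f : T -> R) : (forall x, 0 <= f x) ->
  (\esum_(x in [set: T]) (f x)%:E = (\sum_x f x)%:E)%E.
Proof.
move=> f0; rewrite (esum_fset (@finite_finset _ _)); last first.
  by move=> x _; rewrite lee_fin.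
have -> : [set: T] = [set` index_enum T].
  by apply/seteqP; split=> x //= _; rewrite mem_index_enum.
by rewrite -fsbig_seq ?index_enum_uniq// sumEFin.
Qed.

Lemma sum_mass (T : finType) (d : dist T) : \sum_x d x = 1.
Proof.
have := mass_sum1 d; rewrite esum_finType; last exact: mass_ge0.
by move=> [].
Qed.

Lemma mass_true_false (d : dist bool) : d true + d false = 1.
Proof. by rewrite -(sum_mass d) big_bool. Qed.

(* The uniform distribution on the maximizers of g; the taxes below do not
   depend on how ties are broken. *)
Definition best (g : bool -> R) (a : bool) : bool := [forall b, g b <= g a].

Definition gamma (g : bool -> R) (a : bool) : R :=
  (best g a)%:R / #|[pred b | best g b]|%:R.

End Distributions.

Section Model.
Variables (R : realType) (p : R).

Definition pm (b : bool) : int := if b then 1 else -1.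

Definition Qy (y w : bool) : R := if y == w then 1 - p else p.

Definition q (w : bool) (n : int) : R :=
  let r := ((1 - p) / p) ^ n in if w then r / (r + 1) else 1 / (r + 1).

Definition msum t (m : t.-tuple bool) : int := \sum_(i < t) pm (tnth m i).

Definition past t (x : t.+1.-tuple bool) : t.-tuple bool := [tuple of behead x].

Definition strat (t : nat) := t.+1.-tuple bool -> dist R bool.

Definition policy := forall t, t.-tuple bool -> strat t.

Definition belief_num t (pi : dist R (t.-tuple bool)) (a : bool)
    (theta : strat t) (m : t.+1.-tuple bool) : R :=
  \sum_(w : bool)
    q w (msum (past m)) * pi (past m) * Qy (thead m) w * theta m a.

Definition belief_den t (pi : dist R (t.-tuple bool)) (a : bool)
    (theta : strat t) : R :=
  \sum_(m : t.+1.-tuple bool) belief_num pi a theta m.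

(* When a has probability 0, the next belief is an arbitrary point mass. *)
Definition belief_mass t (pi : dist R (t.-tuple bool)) (a : bool)
    (theta : strat t) (m : t.+1.-tuple bool) : R :=
  if belief_den pi a theta == 0 then (m == [tuple of nseq t.+1 true])%:R
  else belief_num pi a theta m / belief_den pi a theta.

Definition summary_mass t (pi : dist R (t.-tuple bool)) (n : int) : R :=
  \sum_(m : t.-tuple bool | msum m == n) pi m.

Definition truthful t (pi : dist R (t.-tuple bool)) (theta : strat t) : Prop :=
  forall y : bool,
    0 <= \sum_(w : bool) \sum_(m : t.-tuple bool)
           Qy y w * q w (msum m) * pi m
           * (theta [tuple of y :: m] w - theta [tuple of ~~ y :: m] w).

Definition tax t (pi : dist R (t.-tuple bool)) (theta : strat t) : R :=
  \sum_(y : bool) \sum_(w : bool) \sum_(m : t.-tuple bool)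
     Qy y w * q w (msum m) * pi m
     * (theta [tuple of y :: m] w
        - gamma (fun a => Qy y a * \sum_(k : t.-tuple bool) q a (msum k) * pi k)
                w).

Definition sstrat := int -> bool -> dist R bool.

Definition struthful (eta : dist R int) (theta : sstrat) : Prop :=
  forall y : bool,
    0 <= \sum_(w : bool)
           csum (fun n : int => Qy y w * eta n * q w n
                                * (theta n y w - theta n (~~ y) w)).

Definition stax (eta : dist R int) (theta : sstrat) : R :=
  \sum_(y : bool) \sum_(w : bool)
    csum (fun n : int =>
      Qy y w * eta n * q w n
      * (theta n y w
         - gamma (fun a => Qy y a * csum (fun k : int => eta k * q a k)) w)).

Definition act_prob (eta : dist R int) (theta : sstrat) (a : bool) : R :=
  csum (fun n : int => \sum_(w : bool) \sum_(m : bool)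
    eta n * q w n * Qy m w * theta n m a).

Definition summary_num (eta : dist R int) (a : bool) (theta : sstrat)
    (n : int) : R :=
  \sum_(w : bool) \sum_(m : bool)
    eta (n - pm m) * q w (n - pm m) * Qy m w * theta (n - pm m) m a.

(* When a has probability 0, the summary belief is left unchanged; this choice
   has weight 0 in the Bellman equation. *)
Definition supdate_mass (eta : dist R int) (a : bool) (theta : sstrat)
    (n : int) : R :=
  if act_prob eta theta a == 0 then eta n
  else summary_num eta a theta n / act_prob eta theta a.

End Model.

Section Updates.
Variables (R : realType) (p : R) (hp : 0 < p < 2^-1).

Let p_gt0 : 0 < p. Proof. by case/andP: hp. Qed.
Let p_lt1 : p < 1. Proof. by case/andP: hp => _ h; lra. Qed.

Lemma Qy_gt0 y w : 0 < Qy p y w.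
Proof. by rewrite /Qy; case: ifP => _ //; rewrite subr_gt0. Qed.

Lemma Qy_sum1 w : Qy p true w + Qy p false w = 1.
Proof. by case: w; rewrite /Qy /=; ring. Qed.

Lemma odds_gt0 (n : int) : 0 < ((1 - p) / p) ^ n.
Proof. by apply: exprz_gt0; rewrite divr_gt0// subr_gt0. Qed.

Lemma q_ge0 w n : 0 <= q p w n.
Proof.
have r0 := odds_gt0 n.
by rewrite /q; case: w; rewrite divr_ge0// ?addr_ge0// ltW.
Qed.

Lemma q_sum1 n : q p true n + q p false n = 1.
Proof.
have r0 := odds_gt0 n; rewrite /q -mulrDl divff// gt_eqF// addr_gt0//.
Qed.

Lemma belief_num_ge0 t pi a theta m : 0 <= @belief_num R p t pi a theta m.
Proof.
apply: sumr_ge0 => w _; do !(apply: mulr_ge0); rewrite ?mass_ge0 ?q_ge0//.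
exact/ltW/Qy_gt0.
Qed.

Lemma belief_mass_ge0 t pi a theta m : 0 <= @belief_mass R p t pi a theta m.
Proof.
rewrite /belief_mass; case: ifP => _; first exact: ler0n.
apply: divr_ge0; first exact: belief_num_ge0.
by apply: sumr_ge0 => *; exact: belief_num_ge0.
Qed.

Lemma belief_mass_sum1 t pi a theta :
  (\esum_(m in [set: t.+1.-tuple bool])
     (@belief_mass R p t pi a theta m)%:E = 1)%E.
Proof.
rewrite esum_finType; last exact: belief_mass_ge0.
congr EFin; case/boolP: (belief_den p pi a theta == 0) => h; last first.
  under eq_bigr do rewrite /belief_mass (negPf h).
  by rewrite -mulr_suml divff.
under eq_bigr do rewrite /belief_mass h.
rewrite (bigD1 [tuple of nseq t.+1 true])//= eqxx big1 ?addr0// => m.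
by move=> /negPf ->.
Qed.

Definition update t (pi : dist R (t.-tuple bool)) (a : bool) (theta : strat R t) :
    dist R (t.+1.-tuple bool) :=
  Dist (belief_mass_ge0 pi a theta) (belief_mass_sum1 pi a theta).

Lemma summary_mass_ge0 t (pi : dist R (t.-tuple bool)) n :
  0 <= summary_mass pi n.
Proof. by apply: sumr_ge0 => m _; exact: mass_ge0. Qed.

Lemma summary_mass_sum1 t (pi : dist R (t.-tuple bool)) :
  (\esum_(n in [set: int]) (summary_mass pi n)%:E = 1)%E.
Proof.
rewrite -(mass_sum1 pi) esum_finType; last exact: mass_ge0.
rewrite -sumEFin.
transitivity (\esum_(n in [set: int])
    \sum_(m : t.-tuple bool) (if msum m == n then pi m else 0)%:E)%E.
  by apply: eq_esum => n _; rewrite /summary_mass big_mkcond/= sumEFin.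
rewrite esum_sum; last by move=> n m _ _; case: ifP; rewrite lee_fin ?mass_ge0.
apply: eq_bigr => m _.
rewrite (esumID [set msum m])/=; last first.
  by move=> n _; case: ifP; rewrite lee_fin ?mass_ge0.
rewrite setTI esum_set1 ?eqxx ?lee_fin ?mass_ge0// esum1 ?adde0// => n [_ /= hn].
by case: eqP => // e; case: hn.
Qed.

Definition summary t (pi : dist R (t.-tuple bool)) : dist R int :=
  Dist (summary_mass_ge0 pi) (summary_mass_sum1 pi).

Lemma summary_num_ge0 eta a theta n : 0 <= @summary_num R p eta a theta n.
Proof.
apply: sumr_ge0 => w _; apply: sumr_ge0 => m _.
by do !(apply: mulr_ge0); rewrite ?mass_ge0 ?q_ge0// ltW// Qy_gt0.
Qed.

Lemma act_term_ge0 (eta : dist R int) (theta : sstrat R) a n m w :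
  0 <= eta n * q p w n * Qy p m w * theta n m a.
Proof. by do !(apply: mulr_ge0); rewrite ?mass_ge0 ?q_ge0// ltW// Qy_gt0. Qed.

Lemma act_prob_ge0 eta theta a : 0 <= @act_prob R p eta theta a.
Proof.
rewrite /act_prob csum_ge0E; last first.
  by move=> n; do 2!apply: sumr_ge0 => ? _; exact: act_term_ge0.
apply/fine_ge0/esum_ge0 => n _; rewrite lee_fin.
by do 2!apply: sumr_ge0 => ? _; exact: act_term_ge0.
Qed.

Lemma act_term_sum (eta : dist R int) (theta : sstrat R) n :
  \sum_(a : bool) \sum_(w : bool) \sum_(m : bool)
     eta n * q p w n * Qy p m w * theta n m a = eta n.
Proof.
rewrite !big_bool.
have := mass_true_false (theta n true); have := mass_true_false (theta n false).
have := Qy_sum1 true; have := Qy_sum1 false; have := q_sum1 n.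
move: (Qy p true true) (Qy p true false) (Qy p false true) (Qy p false false).
move=> a b c d.
move=> /(canRL (addKr _)) -> /(canRL (addKr _)) -> /(canRL (addKr _)) ->.
move=> /(canRL (addKr _)) -> /(canRL (addKr _)) ->. move: (q p true n) => e /=; ring.
Qed.

Lemma act_prob_esum (eta : dist R int) (theta : sstrat R) a :
  (\esum_(n in [set: int]) (\sum_(w : bool) \sum_(m : bool)
     eta n * q p w n * Qy p m w * theta n m a)%:E
   = (act_prob p eta theta a)%:E)%E.
Proof.
rewrite /act_prob csum_ge0E; last first.
  by move=> n; do 2!apply: sumr_ge0 => ? _; exact: act_term_ge0.
rewrite fineK// ge0_fin_numE; last first.
  apply: esum_ge0 => n _; rewrite lee_fin.
  by do 2!apply: sumr_ge0 => ? _; exact: act_term_ge0.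
apply: (@le_lt_trans _ _ 1%E); last exact: ltry.
rewrite -(mass_sum1 eta); apply: le_esum => n _; rewrite lee_fin.
rewrite -[leRHS](act_term_sum eta theta n) [leRHS](bigD1 a)//= lerDl.
by do 3!apply: sumr_ge0 => ? _; exact: act_term_ge0.
Qed.

Lemma summary_num_esum (eta : dist R int) (theta : sstrat R) a :
  (\esum_(n in [set: int]) (summary_num p eta a theta n)%:E
   = (act_prob p eta theta a)%:E)%E.
Proof.
pose G n m := \sum_(w : bool) eta n * q p w n * Qy p m w * theta n m a.
have G0 n m : 0 <= G n m by apply: sumr_ge0 => w _; exact: act_term_ge0.
transitivity (\esum_(n in [set: int]) \sum_(m : bool) (G (n - pm m) m)%:E)%E.
  by apply: eq_esum => n _; rewrite sumEFin; congr EFin; exact: exchange_big.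
rewrite esum_sum; last by move=> *; rewrite lee_fin.
transitivity (\sum_(m : bool) \esum_(n in [set: int]) (G n m)%:E)%E.
  apply: eq_bigr => m _.
  rewrite [RHS](reindex_esum [set: int] _ (fun n => n - pm m))//.
  split=> //; first by move=> x y _ _; exact: addIr.
  by move=> n _; exists (n + pm m) => //; rewrite addrK.
rewrite -esum_sum; last by move=> *; rewrite lee_fin.
rewrite -act_prob_esum; apply: eq_esum => n _.
by rewrite sumEFin; congr EFin; exact: exchange_big.
Qed.

Lemma supdate_mass_ge0 eta a theta n : 0 <= @supdate_mass R p eta a theta n.
Proof.
rewrite /supdate_mass; case: ifP => _; first exact: mass_ge0.
by rewrite divr_ge0// ?summary_num_ge0// act_prob_ge0.
Qed.

Lemma supdate_mass_sum1 eta a theta :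
  (\esum_(n in [set: int]) (@supdate_mass R p eta a theta n)%:E = 1)%E.
Proof.
case/boolP: (act_prob p eta theta a == 0) => h.
  by rewrite -[RHS](mass_sum1 eta); apply: eq_esum => n _; rewrite /supdate_mass h.
transitivity (\esum_(n in [set: int])
    ((act_prob p eta theta a)^-1 * summary_num p eta a theta n)%:E)%E.
  by apply: eq_esum => n _; rewrite /supdate_mass (negPf h) mulrC.
rewrite esumZl ?invr_ge0 ?act_prob_ge0//; last first.
  by move=> n; exact: summary_num_ge0.
by rewrite summary_num_esum -EFinM mulVf.
Qed.

Definition supdate (eta : dist R int) (a : bool) (theta : sstrat R) :
    dist R int :=
  Dist (supdate_mass_ge0 eta a theta) (supdate_mass_sum1 eta a theta).

Lemma point_mass_sum1 t (x : t.-tuple bool) :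
  (\esum_(y in [set: t.-tuple bool]) ((y == x)%:R : R)%:E = 1)%E.
Proof.
rewrite esum_finType; last by move=> y; exact: ler0n.
by congr EFin; rewrite (bigD1 x)//= eqxx big1 ?addr0// => y /negPf ->.
Qed.

Definition point_mass t (x : t.-tuple bool) : dist R (t.-tuple bool) :=
  Dist (fun y => ler0n R (y == x)) (point_mass_sum1 x).

(* The public belief after the action history a. *)
Fixpoint belief (phi : policy R) t :
    t.-tuple bool -> dist R (t.-tuple bool) :=
  match t with
  | 0 => fun=> point_mass [tuple]
  | s.+1 => fun a => update (belief phi (past a)) (thead a) (phi s (past a))
  end.

Definition feasible (phi : policy R) : Prop :=
  forall t (a : t.-tuple bool), truthful p (belief phi a) (phi t a).

Definition summary_based (phi0 : dist R int -> sstrat R) (phi : policy R) :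
    Prop :=
  forall t (a : t.-tuple bool) (m : t.+1.-tuple bool),
    phi t a m = phi0 (summary (belief phi a)) (msum (past m)) (thead m).

Definition bellman (delta : R) (V : dist R int -> R) (eta : dist R int)
    (theta : sstrat R) : R :=
  stax p eta theta
  + delta * \sum_(a : bool) act_prob p eta theta a * V (supdate eta a theta).

End Updates.

Definition is_max (R : realType) (T : Type) (S : set T) (F : T -> R) (v : R) :
    Prop :=
  (exists2 x, S x & F x = v) /\ forall x, S x -> F x <= v.

Definition argmax (R : realType) (T : Type) (S : set T) (F : T -> R) : set T :=
  [set x | S x /\ forall y, S y -> F y <= F x].

Section Process.
Variables (R : realType) (p : R).

(* The probability of W = w, Y^t = y and A^t = a under phi. *)
Fixpoint path_prob (phi : policy R) (w : bool) t :
    t.-tuple bool -> t.-tuple bool -> R :=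
  match t with
  | 0 => fun _ _ => 2^-1
  | s.+1 => fun y a =>
      path_prob phi w (past y) (past a)
      * Qy p (thead y) w * phi s (past a) y (thead a)
  end.

Fixpoint hist (T : Type) (X : nat -> T -> bool) t (omega : T) :
    t.-tuple bool :=
  match t with
  | 0 => [tuple]
  | s.+1 => [tuple of X s omega :: hist X s omega]
  end.

(* On the probability space P, the state W, the signals Y (which are also the
   messages) and the public actions A follow the law induced by phi. *)
Definition realizes (phi : policy R) d (Omega : measurableType d)
    (P : probability Omega R) (W : {mfun Omega >-> bool})
    (Y A : nat -> {mfun Omega >-> bool}) : Prop :=
  forall t (w : bool) (y a : t.-tuple bool),
    P [set omega | [/\ W omega = w, hist Y t omega = y & hist A t omega = a]]
    = (path_prob phi w y a)%:E.

End Process.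

Section Existence.
Variables (R : realType) (p : R) (hp : 0 < p < 2^-1) (phi : policy R).

Let pp := path_prob p phi.

Let pp_ge0 w t (y a : t.-tuple bool) : 0 <= pp w y a.
Proof.
elim: t y a => [|t IH] y a /=; first by rewrite invr_ge0 ler0n.
apply: mulr_ge0; last exact: mass_ge0.
by apply: mulr_ge0; [exact: IH | exact/ltW/Qy_gt0].
Qed.

(* A uniform variable on [0, 1] drives the process: the history (w, y, a) is
   the interval of length [path_prob] and lower bound [lo]. *)
Let loY w t (y a : t.-tuple bool) (l : R) (y' : bool) : R :=
  l + pp w y a * (if y' then 0 else Qy p true w).
Let lenY w t (y a : t.-tuple bool) (y' : bool) : R := pp w y a * Qy p y' w.

Let lo w : forall t, t.-tuple bool -> t.-tuple bool -> R :=
  fix lo t := match t with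
  | 0 => fun _ _ => if w then 0 else 2^-1
  | s.+1 => fun y a =>
      loY w (past y) (past a) (lo s (past y) (past a)) (thead y)
      + lenY w (past y) (past a) (thead y)
        * (if thead a then 0 else phi (past a) y true)
  end.

Let W0 (x : R) : bool := x < 2^-1.

Let nextY x t (y a : t.-tuple bool) : bool :=
  x < lo (W0 x) y a + pp (W0 x) y a * Qy p true (W0 x).

Let nextA x t (y a : t.-tuple bool) (y' : bool) : bool :=
  x < loY (W0 x) y a (lo (W0 x) y a) y'
      + lenY (W0 x) y a y' * phi a [tuple of y' :: y] true.

Let trace (x : R) : forall t, t.-tuple bool * t.-tuple bool :=
  fix trace t := match t with
  | 0 => ([tuple], [tuple])
  | s.+1 => let: (y, a) := trace s in
      let y' := nextY x y a in
      ([tuple of y' :: y], [tuple of nextA x y a y' :: a])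
  end.

Let Y0 s x := nextY x (trace x s).1 (trace x s).2.
Let A0 s x := nextA x (trace x s).1 (trace x s).2 (Y0 s x).

Let traceS x s : trace x s.+1 =
  ([tuple of Y0 s x :: (trace x s).1], [tuple of A0 s x :: (trace x s).2]).
Proof. by rewrite /A0 /Y0 /=; case: (trace x s). Qed.

Let traceE x t : trace x t = (hist Y0 t x, hist A0 t x).
Proof.
elim: t => [//|t IH]; rewrite traceS IH /=.
by congr pair; apply: val_inj.
Qed.

Let past_cons t b (x : t.-tuple bool) : past [tuple of b :: x] = x.
Proof. exact: val_inj. Qed.

Let cell w t (y a : t.-tuple bool) : set R :=
  [set x | W0 x = w /\ trace x t = (y, a)].

Let cons_inj t b b' (x x' : t.-tuple bool) :
  [tuple of b :: x] = [tuple of b' :: x'] -> b = b' /\ x = x'.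
Proof. by move=> /(congr1 val) /= [-> /val_inj]. Qed.

Let cellS w t y' a' (y a : t.-tuple bool) x :
  cell w [tuple of y' :: y] [tuple of a' :: a] x <->
  cell w y a x /\
     ((x < lo w y a + pp w y a * Qy p true w) = y' /\
      (x < loY w y a (lo w y a) y'
           + lenY w y a y' * phi a [tuple of y' :: y] true) = a').
Proof.
rewrite /cell /mkset traceS; split.
- case=> <- /pair_equal_spec[/cons_inj[e1 e2] /cons_inj[e3 e4]].
  have et : trace x t = (y, a) by rewrite -e2 -e4; case: (trace x t).
  split=> //; move: e1 e3; rewrite /A0 /Y0 et /= /nextY /nextA => e1.
  by rewrite e1.
- case=> -[<- et] [e1 e3]; split=> //.
  by rewrite /A0 /Y0 et /= /nextY /nextA e1 e3.
Qed.

Let split_itv (x l L c : R) (b : bool) : 0 <= L -> 0 <= c <= 1 ->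
  (l <= x < l + L /\ (x < l + L * c) = b) <->
  (l + L * (if b then 0 else c) <= x <
   l + L * (if b then 0 else c) + L * (if b then c else 1 - c)).
Proof.
move=> L0 /andP[c0 c1].
have h0 : 0 <= L * c by apply: mulr_ge0.
have h1 : L * c <= L by rewrite ler_piMr.
case: b; rewrite ?mulr0 ?addr0 ?mulrBr ?mulr1; split.
- by case=> /andP[-> _] ->.
- by case/andP => -> h; rewrite h; split=> //; apply: lt_le_trans h _; lra.
- by case=> /andP[_ h] /negbT; rewrite -leNgt => ->; lra.
- case/andP => h h'; split; [lra | by apply: negbTE; rewrite -leNgt].
Qed.

Let cell_itv w t (y a : t.-tuple bool) x : 0 <= x < 1 ->
  cell w y a x <-> lo w y a <= x < lo w y a + pp w y a.
Proof.
move=> x01; elim: t y a => [|t IH] y a.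
  have hh : (2^-1 : R) + 2^-1 = 1 by lra.
  rewrite (tuple0 y) (tuple0 a) /cell /pp /= /W0; split.
    case=> <- _; case/andP: x01 => x0 x1.
    by case: ltP => h /=; rewrite ?add0r ?x0 ?h ?hh.
  case/andP: x01 => x0 x1; case: w => /andP[h1 h2]; split=> //.
    by rewrite add0r in h2.
  by apply: negbTE; rewrite -leNgt.
case/tupleP: y => y' y; case/tupleP: a => a' a.
rewrite (cellS w y' a' y a x) (IH y a).
rewrite /pp /= !past_cons !theadE -/(lo w) -/pp.
have L0 := pp_ge0 w y a.
have c1 : 0 <= Qy p true w <= 1.
  have := Qy_gt0 hp true w; have := Qy_gt0 hp false w; have := Qy_sum1 p w.
  by lra.
have := split_itv x (lo w y a) y' L0 c1.
have -> : (if y' then Qy p true w else 1 - Qy p true w) = Qy p y' w.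
  by case: y' => //; rewrite -(Qy_sum1 p w); ring.
rewrite -/(loY w y a (lo w y a) y') -/(lenY w y a y') => hY.
have L1 : 0 <= lenY w y a y' by apply: mulr_ge0 => //; exact/ltW/Qy_gt0.
set th := phi a [tuple of y' :: y].
have c2 : 0 <= th true <= 1.
  have := mass_ge0 th true; have := mass_ge0 th false.
  have := mass_true_false th; lra.
have := split_itv x (loY w y a (lo w y a) y') a' L1 c2.
have -> : (if a' then th true else 1 - th true) = th a'.
  by case: a' => //; rewrite -(mass_true_false th); ring.
move=> hA; rewrite -hA -hY; tauto.
Qed.

Let measurable_cell w t (y a : t.-tuple bool) :
  measurable (cell w y a : set (measurableTypeR R)).
Proof.
have mlt (c : R) b : measurable [set x : measurableTypeR R | (x < c) = b].
  rewrite (_ : [set _ | _] = [set` if b then `]-oo, c[ else `[c, +oo[]).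
    by case: b; exact: measurable_itv.
  apply/seteqP; split=> x; case: b; rewrite /= in_itv/= ?andbT //.
  - by move=> /negbT; rewrite -leNgt.
  - by rewrite leNgt => /negbTE.
elim: t y a => [|t IH] y a.
  rewrite (_ : cell _ _ _ = [set x | (x < 2^-1) = w]); first exact: mlt.
  apply/seteqP; split=> x; first by case.
  by move=> h; split=> //; rewrite (tuple0 y) (tuple0 a).
case/tupleP: y => y' y; case/tupleP: a => a' a.
rewrite (_ : cell _ _ _ = cell w y a `&`
   ([set x | (x < lo w y a + pp w y a * Qy p true w) = y'] `&`
    [set x | (x < loY w y a (lo w y a) y'
           + lenY w y a y' * phi a [tuple of y' :: y] true) = a'])).
  by do 2 (apply: measurableI => //).
by apply/seteqP; split => x /cellS.
Qed.

Let P : probability (measurableTypeR R) R := uniform_prob (@ltr01 R).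

Let P_itv (l u : R) : 0 <= l -> l <= u -> u <= 1 ->
  P `[l, u[%classic = (u - l)%:E.
Proof.
move=> l0 lu u1; rewrite /P /= /uniform_prob.
rewrite (eq_integral (fun=> 1%E)); last first.
  move=> x; rewrite inE/= in_itv/= => /andP[h1 h2]; rewrite /uniform_pdf.
  by rewrite (le_trans l0 h1) (ltW (lt_le_trans h2 u1)) subr0 invr1.
rewrite integral_cst/=; last exact: measurable_itv.
rewrite mul1e lebesgue_measure_itv/= lte_fin.
by case: ltgtP lu => // -> _; rewrite subrr.
Qed.

Let lo_bounds w t (y a : t.-tuple bool) :
  0 <= lo w y a /\ lo w y a + pp w y a <= 1.
Proof.
elim: t y a => [|t IH] y a.
  by rewrite /pp /=; case: w; split; lra.
case/tupleP: y => y' y; case/tupleP: a => a' a.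
rewrite /pp /= !past_cons !theadE -/(lo w) -/pp.
have [h0 h1] := IH y a; rewrite /loY /lenY.
have L0 := pp_ge0 w y a.
have q0 := Qy_gt0 hp y' w; have q1 := Qy_sum1 p w.
have q2 := Qy_gt0 hp true w.
set th := phi a [tuple of y' :: y].
have t0 := mass_ge0 th true; have t1 := mass_ge0 th false.
have t2 := mass_true_false th.
move: (lo w y a) h0 h1 L0 => l h0 h1.
move: (pp w y a) => L in h1 *; move=> L0.
have m0 : 0 <= L * Qy p false w by rewrite mulr_ge0// ltW// Qy_gt0.
have m1 : 0 <= L * Qy p true w by rewrite mulr_ge0// ltW.
have m2 : 0 <= L * Qy p y' w by rewrite mulr_ge0// ltW.
have m3 : 0 <= L * Qy p y' w * th true by rewrite mulr_ge0.
have m4 : 0 <= L * Qy p y' w * th false by rewrite mulr_ge0.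
have e1 : L * Qy p true w + L * Qy p false w = L by rewrite -mulrDr q1 mulr1.
have e2 : L * Qy p y' w * th true + L * Qy p y' w * th false = L * Qy p y' w.
  by rewrite -mulrDr t2 mulr1.
case: y' @th q0 t0 t1 t2 m2 m3 m4 e2 => th q0 t0 t1 t2 m2 m3 m4 e2;
  case: a'; rewrite ?mulr0 ?addr0; split; lra.
Qed.

Let P_cell w t (y a : t.-tuple bool) : P (cell w y a) = (pp w y a)%:E.
Proof.
have mI (l u : R) : measurable (`[l, u[%classic : set (measurableTypeR R)).
  exact: measurable_itv.
have P01 : P `[0, 1[%classic = 1%E by rewrite P_itv ?subr0.
have [lo0 lo1] := lo_bounds w y a; have L0 := pp_ge0 w y a.
rewrite -(setIT (cell w y a)) -(setUv `[0, 1[%classic) setIUr measureU; last 3 first.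
- by apply: measurableI => //; exact: measurable_cell.
- by apply: measurableI; [exact: measurable_cell | exact: measurableC].
- by rewrite setIACA setICr setI0.
rewrite [X in (_ + X)%E](_ : _ = 0%E) ?adde0; last first.
  apply: (@subset_measure0 _ _ _ P _ (~` `[0, 1[%classic)).
  - by apply: measurableI; [exact: measurable_cell | exact: measurableC].
  - exact: measurableC.
  - by move=> x [].
  - by apply: etrans (probability_setC P (mI 0 1)) _; rewrite P01 subee.
rewrite (_ : _ `&` _ = `[lo w y a, lo w y a + pp w y a[%classic).
  apply: etrans (P_itv lo0 _ lo1) _; first by rewrite lerDl.
  by congr EFin; ring.
apply/seteqP; split=> x; rewrite /= !in_itv/=.
- by case=> h x01; apply/(cell_itv w y a x01).
- move=> /[dup] h /andP[h1 h2].
  have x01 : 0 <= x < 1.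
    by rewrite (le_trans lo0 h1) (lt_le_trans h2 lo1).
  by split=> //; apply/(cell_itv w y a x01).
Qed.

Let measurable_of_cells (f : measurableTypeR R -> bool) t
    (g : bool * (t.-tuple bool * t.-tuple bool) -> bool) :
  (forall x, f x = g (W0 x, trace x t)) -> measurable_fun [set: _] f.
Proof.
move=> fE; apply: (measurable_fun_bool true); rewrite setTI.
rewrite (_ : _ @^-1` _ =
    \bigcup_(i in [set i | g i]) cell i.1 i.2.1 i.2.2); last first.
  apply/seteqP; split=> x /=.
  - rewrite fE => h; exists (W0 x, trace x t) => //=.
    by split=> //=; case: (trace x t).
  - by case=> -[w [y a]] /= h [eW e]; rewrite fE eW e.
apply: fin_bigcup_measurable => // i _; exact: measurable_cell.
Qed.

(* Every policy is realized on some probability space. *)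
Lemma realizable : exists (W : {mfun measurableTypeR R >-> bool})
  (Y A : nat -> {mfun measurableTypeR R >-> bool}),
  realizes p phi (uniform_prob (@ltr01 R)) W Y A.
Proof.
have mW : measurable_fun [set: measurableTypeR R] W0.
  by apply: (@measurable_of_cells _ 0 (fun i => i.1)).
have mY s : measurable_fun [set: measurableTypeR R] (Y0 s).
  apply: (@measurable_of_cells _ s.+1 (fun i => thead i.2.1)) => x.
  by rewrite traceS theadE.
have mA s : measurable_fun [set: measurableTypeR R] (A0 s).
  apply: (@measurable_of_cells _ s.+1 (fun i => thead i.2.2)) => x.
  by rewrite traceS theadE.
pose mk (f : measurableTypeR R -> bool) (mf : measurable_fun [set: _] f) :
  {mfun measurableTypeR R >-> bool} :=
  HB.pack_for {mfun measurableTypeR R >-> bool} f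
    (isMeasurableFun.Build _ _ _ _ f mf).
exists (mk _ mW), (fun s => mk _ (mY s)), (fun s => mk _ (mA s)).
move=> t w y a; rewrite -/pp -P_cell; congr (P _).
apply/seteqP; split=> x; rewrite /cell /= traceE.
- by case=> -> <- <-.
- by case=> -> [<- <-].
Qed.
End Existence.

Section Optimality.
Variables (R : realType) (p delta : R) (hp : 0 < p < 2^-1).

(* Discounted sum of the taxes along a realization of the actions. *)
Definition payoff (phi : policy R) d (Omega : measurableType d)
    (A : nat -> {mfun Omega >-> bool}) (omega : Omega) : R :=
  limn (series (fun t =>
    delta ^+ t * tax p (belief hp phi (hist A t omega))
                       (phi t (hist A t omega)))).

(* The expectation depends only on the law of A, hence not on the probability
   space; by [realizable], the quantification over spaces is not vacuous. *)
Definition optimal (phi : policy R) : Prop :=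
  feasible hp phi /\
  forall phi' : policy R, feasible hp phi' ->
  forall d (Omega : measurableType d) (P : probability Omega R)
    (W : {mfun Omega >-> bool}) (Y A : nat -> {mfun Omega >-> bool})
    d' (Omega' : measurableType d') (P' : probability Omega' R)
    (W' : {mfun Omega' >-> bool}) (Y' A' : nat -> {mfun Omega' >-> bool}),
  realizes p phi P W Y A -> realizes p phi' P' W' Y' A' ->
  ('E_P'[payoff phi' A'] <= 'E_P[payoff phi A])%E.

End Optimality.

(* Main.v *)
(** The prescriptions after every finite sequence of public actions form a point
    of a product of segments, which is compact.  The discounted value of such a
    contingent plan is continuous and the truth-telling constraints are closed,
    so from every summary belief there is an optimal plan; this avoids any
    regularity of the value function V in the belief.  Splitting a plan into its
    first prescription and its continuations, and conversely concatenating
    optimal continuations, gives the Bellman equation with attained maximum.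
    Beliefs are left unnormalized here: everything is then homogeneous of degree
    1 and actions of probability zero need no separate treatment.

    Averaging a partial strategy over the histories with a given summary changes
    neither the tax, nor the truth-telling constraints, nor the law of the next
    summary belief.  Hence collected rewards plus discounted V is a
    supermartingale under any feasible policy and a martingale under the
    stationary maximizer, which is therefore optimal. *)
Require Import Defs.
From mathcomp Require Import all_boot all_order all_algebra.
From mathcomp Require Import all_classical all_reals all_analysis.
From mathcomp Require Import measurable_realfun.
From mathcomp Require Import ring lra.
(* The measure library also exports a constant [msum]. *)
Import Defs.

Set Implicit Arguments.
Unset Strict Implicit.
Unset Printing Implicit Defensive.
Import Order.TTheory GRing.Theory Num.Theory.
Import numFieldNormedType.Exports.

Local Open Scope classical_set_scope.
Local Open Scope ring_scope.

(** * Sums over countable types *)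

Section CountableSums.
Variables (R : realType) (S : choiceType).
Implicit Types f g b : S -> R.

Definition csummable f := summable [set: S] (EFin \o f).

Lemma csummable_le f b : (forall x, `|f x| <= b x) -> csummable b -> csummable f.
Proof.
move=> fb; apply: le_lt_trans; apply: le_esum => x _ /=; rewrite lee_fin.
exact: le_trans (fb x) (ler_norm _).
Qed.

Lemma csummableD f g : csummable f -> csummable g -> csummable (f \+ g).
Proof. by move=> hf hg; exact: summableD hf hg. Qed.

Lemma csummableN f : csummable f -> csummable (\- f).
Proof. by rewrite /csummable (summableN _ (EFin \o f)). Qed.

Lemma csummableZ c f : csummable f -> csummable (fun x => c * f x).
Proof.
move=> hf; rewrite /csummable /summable.
rewrite (eq_esum (b := fun x => (`|c| * `|f x|)%:E)); last first.
  by move=> x _ /=; rewrite normrM.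
rewrite esumZl//; move: hf; rewrite /csummable summableE => hf.
by rewrite ltey_eq fin_numM.
Qed.

Lemma csummable0 : csummable (fun=> 0).
Proof. by rewrite /csummable /summable esum1 ?ltry// => x _ /=; rewrite normr0. Qed.

Lemma csummable_sum (I : Type) (r : seq I) (F : I -> S -> R) :
  (forall i, csummable (F i)) -> csummable (fun x => \sum_(i <- r) F i x).
Proof.
move=> hF; elim: r => [|i r IH].
  by under [X in csummable X]eq_fun do rewrite big_nil; exact: csummable0.
by under [X in csummable X]eq_fun do rewrite big_cons; exact: csummableD.
Qed.

Lemma csum_ge0_fin f : (forall x, 0 <= f x) -> csummable f ->
  (\esum_(x in [set: S]) (f x)%:E = (csum f)%:E)%E.
Proof.
move=> f0 hf; rewrite csum_ge0E// fineK//.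
rewrite /csummable summableE in hf.
by rewrite (eq_esum (b := fun x => `|(EFin \o f) x|%E))// => x _ /=; rewrite ger0_norm.
Qed.

Lemma csumB_ge0 f g : (forall x, 0 <= f x) -> (forall x, 0 <= g x) ->
  csummable f -> csummable g -> csum (f \- g) = csum f - csum g.
Proof.
move=> f0 g0 hf hg; rewrite {1}/csum.
rewrite (_ : EFin \o _ = (EFin \o f) \- (EFin \o g))%E//.
by rewrite esumB//= => [|x _|x _]; rewrite ?csum_ge0_fin ?lee_fin.
Qed.

(** Positive and negative parts are not additive, so the definition of [csum] does not give this
    directly. Both families are written as differences of nonnegative ones and regrouped, which
    leaves [csumB_ge0] and additivity for nonnegative families. *)
Lemma csumD f g : csummable f -> csummable g -> csum (f \+ g) = csum f + csum g.
Proof.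
have pos h : csummable h -> csummable (fun x => Num.max (h x) 0) /\
    csummable (fun x => Num.max (- h x) 0) /\
    h = (fun x => Num.max (h x) 0) \- (fun x => Num.max (- h x) 0).
  move=> hh; split; last split.
  - apply: (csummable_le (b := fun x => `|h x|)) => [x|].
      by rewrite ger0_norm ?le_max ?lexx ?orbT// ge_max normr_ge0 ler_norm.
    rewrite /csummable /summable /=; under eq_esum do rewrite normr_id; exact: hh.
  - apply: (csummable_le (b := fun x => `|h x|)) => [x|].
      by rewrite ger0_norm ?le_max ?lexx ?orbT// ge_max normr_ge0 -normrN ler_norm.
    rewrite /csummable /summable /=; under eq_esum do rewrite normr_id; exact: hh.
  - apply/funext => x /=; case: (lerP (h x) 0) => hx.
      by rewrite max_l ?oppr_ge0// sub0r opprK.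
    by rewrite max_r ?subr0// oppr_le0 ltW.
have m0 (h : S -> R) x : 0 <= Num.max (h x) 0 by rewrite le_max lexx orbT.
have addE u v : (forall x, 0 <= u x) -> (forall x, 0 <= v x) ->
    csummable u -> csummable v -> csum (u \+ v) = csum u + csum v.
  move=> u0 v0 hu hv; apply: EFin_inj; rewrite EFinD -!csum_ge0_fin//.
  - by rewrite -esumD// => x _; rewrite lee_fin.
  - by move=> x; exact: addr_ge0.
  - exact: csummableD.
move=> /pos[f1 [f2 ef]] /pos[g1 [g2 eg]]; rewrite ef eg.
set fp := (fun x => Num.max (f x) 0) in ef f1 *.
set fn := (fun x => Num.max (- f x) 0) in ef f2 *.
set gp := (fun x => Num.max (g x) 0) in eg g1 *.
set gn := (fun x => Num.max (- g x) 0) in eg g2 *.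
have -> : (fp \- fn) \+ (gp \- gn) = (fp \+ gp) \- (fn \+ gn).
  by apply/funext => x /=; ring.
have fp0 x : 0 <= fp x := m0 f x.
have fn0 x : 0 <= fn x := m0 (fun x => - f x) x.
have gp0 x : 0 <= gp x := m0 g x.
have gn0 x : 0 <= gn x := m0 (fun x => - g x) x.
rewrite !csumB_ge0 //=; try exact: csummableD; try by move=> x /=; exact: addr_ge0.
by rewrite !addE//; ring.
Qed.

Lemma eq_csum f g : f =1 g -> csum f = csum g.
Proof. by move=> /funext ->. Qed.

Lemma csum0 : csum (fun _ : S => 0 : R) = 0.
Proof. by rewrite csum_ge0E// esum1. Qed.

Lemma csumN f : csummable f -> csum (\- f) = - csum f.
Proof.
move=> hf; apply/eqP; rewrite -addr_eq0 -csumD//; last exact: csummableN.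
rewrite (eq_csum (g := fun=> 0)) ?csum0// => x /=; exact: addNr.
Qed.

Lemma csumB f g : csummable f -> csummable g -> csum (f \- g) = csum f - csum g.
Proof. by move=> hf hg; rewrite -csumN// -csumD//; exact: csummableN. Qed.

Lemma csumZ c f : csummable f -> csum (fun x => c * f x) = c * csum f.
Proof.
have ge0 a h : 0 <= a -> (forall x, 0 <= h x) -> csummable h ->
    csum (fun x => a * h x) = a * csum h.
  move=> a0 h0 hh; rewrite csum_ge0E; last by move=> x; exact: mulr_ge0.
  by rewrite esumZl// csum_ge0_fin// -EFinM.
have pos h : csummable h -> exists u v : S -> R, [/\ csummable u, csummable v,
    forall x, 0 <= u x, forall x, 0 <= v x & h = u \- v].
  move=> hh; have ah : csummable (fun x => `|h x|).
    by rewrite /csummable /summable /=; under eq_esum do rewrite normr_id; exact: hh.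
  (* Any splitting into nonnegative summable families serves here; this one avoids a case split on
     the sign of [h x]. *)
  exists (fun x => `|h x| + h x), (fun x => `|h x|); split=> //.
  - exact: csummableD.
  - by move=> x; rewrite -lerBlDr sub0r -normrN ler_norm.
  - by apply/funext => x /=; ring.
have ge0' a h : 0 <= a -> csummable h -> csum (fun x => a * h x) = a * csum h.
  move=> a0 /pos[u [v [hu hv u0 v0 ->]]].
  rewrite (eq_csum (g := (fun x => a * u x) \- (fun x => a * v x))); last first.
    by move=> x /=; rewrite mulrBr.
  rewrite !csumB ?ge0//; try exact: csummableZ.
  by rewrite mulrBr.
move=> hf; case: (lerP 0 c) => c0; first exact: ge0'.
rewrite (eq_csum (g := \- (fun x => (- c) * f x))); last first.
  by move=> x /=; rewrite mulNr opprK.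
rewrite csumN; last exact: csummableZ.
by rewrite ge0' ?oppr_ge0 ?ltW// mulNr opprK.
Qed.

Lemma csum_sum (I : Type) (r : seq I) (F : I -> S -> R) :
  (forall i, csummable (F i)) ->
  csum (fun x => \sum_(i <- r) F i x) = \sum_(i <- r) csum (F i).
Proof.
move=> hF; elim: r => [|i r IH].
  by under eq_csum do rewrite big_nil; rewrite big_nil csum0.
under eq_csum do rewrite big_cons.
by rewrite big_cons -IH -csumD//; exact: csummable_sum.
Qed.

Lemma csum_ge0 f : (forall x, 0 <= f x) -> 0 <= csum f.
Proof.
by move=> f0; rewrite csum_ge0E//; apply/fine_ge0/esum_ge0 => x _; rewrite lee_fin.
Qed.

Lemma le_csum f g : csummable f -> csummable g -> (forall x, f x <= g x) ->
  csum f <= csum g.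
Proof.
move=> hf hg fg; rewrite -subr_ge0 -csumB//; apply: csum_ge0 => x /=.
by rewrite subr_ge0.
Qed.

Lemma ler_norm_csum f b : (forall x, `|f x| <= b x) -> csummable b ->
  `|csum f| <= csum b.
Proof.
move=> fb hb; have hf := csummable_le fb hb.
rewrite ler_norml -csumN//; apply/andP; split; apply: le_csum => //=.
- exact: csummableN.
- by move=> x; rewrite lerNl (le_trans _ (fb x))// -normrN ler_norm.
- by move=> x; rewrite (le_trans _ (fb x))// ler_norm.
Qed.

Lemma csummable_delta (k : S) (c : R) : csummable (fun n => if n == k then c else 0).
Proof.
rewrite /csummable /summable (esumID [set k])//= setTI esum_set1//= eqxx.
by rewrite esum1 ?adde0 ?ltry// => n [_ /= hn]; case: eqP => // ; rewrite normr0.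
Qed.

Lemma csum_delta (k : S) (c : R) : csum (fun n => if n == k then c else 0) = c.
Proof.
have ge0 a : 0 <= a -> csum (fun n => if n == k then a else 0) = a.
  move=> a0; rewrite csum_ge0E; last by move=> x; case: ifP.
  rewrite (esumID [set k])/=; last by move=> x _; case: ifP; rewrite lee_fin.
  rewrite setTI esum_set1/= ?eqxx ?lee_fin// esum1 ?adde0//.
  by move=> n [_ /= hn]; case: eqP.
have [c0|c0] := lerP 0 c; first exact: ge0.
rewrite (eq_csum (g := \- (fun n => if n == k then - c else 0))); last first.
  by move=> x /=; case: ifP; rewrite ?opprK ?oppr0.
by rewrite csumN ?ge0 ?opprK ?oppr_ge0 ?ltW//; exact: csummable_delta.
Qed.

End CountableSums.

(** Each [m] contributes a family supported at the single point [h m], so the countable sum is a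
    finite sum of such families. *)
Lemma csum_fiber (R : realType) (T : finType) (S : choiceType) (h : T -> S)
    (G : T -> R) :
  csum (fun n => \sum_(m | h m == n) G m) = \sum_m G m.
Proof.
rewrite (eq_csum (g := fun n => \sum_m if n == h m then G m else 0)); last first.
  by move=> n; rewrite big_mkcond; apply: eq_bigr => m _; rewrite eq_sym.
rewrite csum_sum; last by move=> m; exact: csummable_delta.
by apply: eq_bigr => m _; rewrite csum_delta.
Qed.

Lemma csummable_shift (R : realType) (f : int -> R) k :
  csummable f -> csummable (fun n => f (n - k)).
Proof.
rewrite /csummable /summable => hf.
rewrite -(reindex_esum [set: int] [set: int] (fun n => n - k)
  (fun n => `|(EFin \o f) n|%E))//.
split=> //; first by move=> x y _ _; exact: addIr.
by move=> n _; exists (n + k) => //; rewrite addrK.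
Qed.

Lemma csum_shift (R : realType) (f : int -> R) k : (forall n, 0 <= f n) ->
  csum (fun n => f (n - k)) = csum f.
Proof.
move=> f0; rewrite !csum_ge0E//; congr fine.
rewrite -(reindex_esum [set: int] [set: int] (fun n => n - k) (fun n => (f n)%:E))//.
split=> //; first by move=> x y _ _; exact: addIr.
by move=> n _; exists (n + k) => //; rewrite addrK.
Qed.

(** * Continuity of series *)

Section Continuity.
Variables (R : realType) (T : topologicalType).
Implicit Types f g : T -> R.

Lemma continuous_cstr (c : R) : continuous (fun _ : T => c).
Proof. by move=> x; exact: cvg_cst. Qed.

Lemma continuous_addr f g :
  continuous f -> continuous g -> continuous (fun x => f x + g x).
Proof. by move=> hf hg x; apply: cvgD; [exact: hf | exact: hg]. Qed.

Lemma continuous_oppr f : continuous f -> continuous (fun x => - f x).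
Proof. by move=> hf x; apply: cvgN; exact: hf. Qed.

Lemma continuous_mulr f g :
  continuous f -> continuous g -> continuous (fun x => f x * g x).
Proof. by move=> hf hg x; apply: cvgM; [exact: hf | exact: hg]. Qed.

Lemma continuous_maxr f g :
  continuous f -> continuous g -> continuous (fun x => Num.max (f x) (g x)).
Proof. by move=> hf hg x; apply: continuous_max; [exact: hf | exact: hg]. Qed.

Lemma continuous_minr f g :
  continuous f -> continuous g -> continuous (fun x => Num.min (f x) (g x)).
Proof. by move=> hf hg x; apply: continuous_min; [exact: hf | exact: hg]. Qed.

Lemma continuous_sumr (I : Type) (r : seq I) (F : I -> T -> R) :
  (forall i, continuous (F i)) -> continuous (fun x => \sum_(i <- r) F i x).
Proof.
move=> hF; elim: r => [|i r IH].
  by under eq_fun do rewrite big_nil; exact: continuous_cstr.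
by under eq_fun do rewrite big_cons; exact: continuous_addr.
Qed.

(** A uniform limit of continuous functions is continuous, by the usual three-term estimate. *)
Lemma continuous_uniform_approx f :
  (forall e, 0 < e -> exists2 g, continuous g & forall x, `|f x - g x| <= e) ->
  continuous f.
Proof.
move=> H x0; apply/cvgrPdist_lt => e e0.
have e4 : 0 < e / 4 by rewrite divr_gt0.
have [g cg fg] := H _ e4.
have /cvgrPdist_lt/(_ _ e4) := cg x0; apply: filterS => x gx.
have := fg x; have := fg x0; move: gx; rewrite !ltr_norml !ler_norml.
move=> /andP[? ?] /andP[? ?] /andP[? ?]; apply/andP; split; lra.
Qed.

Lemma csum_seq (S : choiceType) (r : seq S) (f : S -> R) : uniq r ->
  csum (fun n => if n \in r then f n else 0) = \sum_(n <- r) f n.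
Proof.
move=> ur.
rewrite (eq_csum (g := fun n => \sum_(k <- r) if n == k then f k else 0)).
  rewrite csum_sum; last by move=> m; exact: csummable_delta.
  by apply: eq_bigr => k _; rewrite csum_delta.
move=> n; case: ifP => nr.
  rewrite (bigD1_seq n)//= eqxx big1 ?addr0// => k kn.
  by rewrite eq_sym (negPf kn).
rewrite big_seq big1// => k kr; case: eqP => // nk.
by rewrite nk kr in nr.
Qed.

(** The total is the supremum of the finite partial sums, so some finite set comes within [e] of it;
    the tail is what remains outside. *)
Lemma csummable_tail (S : choiceType) (b : S -> R) e :
  (forall n, 0 <= b n) -> csummable b -> 0 < e ->
  exists2 r : seq S, uniq r & csum (fun n => if n \in r then 0 else b n) < e.
Proof.
move=> b0 hb e0.
have E := csum_ge0_fin b0 hb.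
have fin : ereal_sup [set (\sum_(x \in A) (b x)%:E)%E | A in fsets [set: S]]
    \is a fin_num by move: E; rewrite /esum => ->.
have [_ [A [finA _] <-]] := ub_ereal_sup_adherent e0 fin.
rewrite [X in (X - _ < _)%E]E.
rewrite fsbig_finite//= sumEFin -EFinB lte_fin => hA.
set r := finmap.enum_fset _ in hA.
have ur : uniq r := finmap.fset_uniq _; exists r => //.
have hr : csummable (fun n => if n \in r then b n else 0).
  apply: csummable_le hb => n.
  by case: ifP => _; rewrite ?normr0// ger0_norm.
rewrite (eq_csum (g := b \- (fun n => if n \in r then b n else 0))).
  by rewrite csumB// csum_seq//; lra.
by move=> n /=; case: ifP; rewrite ?subrr ?subr0.
Qed.

(** Weierstrass M-test: finite partial sums approximate uniformly, with an error controlled by the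
    tail of [b]. *)
Lemma continuous_csum (S : choiceType) (F : T -> S -> R) (b : S -> R) :
  csummable b -> (forall x n, `|F x n| <= b n) ->
  (forall n, continuous (F ^~ n)) -> continuous (fun x => csum (F x)).
Proof.
move=> hb Fb cF; apply: continuous_uniform_approx => e e0.
(* Nonnegativity of [b] is read off its domination of [F] at some point, so an empty [T] is settled
   first. *)
have [[x0 _]|T0] := pselect (exists x : T, True); last first.
  exists (fun x => csum (F x)); last by move=> x; case: T0; exists x.
  by move=> x; case: T0; exists x.
have b0 n : 0 <= b n := le_trans (normr_ge0 _) (Fb x0 n).
have [r ur hr] := csummable_tail b0 hb e0.
exists (fun x => \sum_(n <- r) F x n); first exact: continuous_sumr.
move=> x; rewrite -csum_seq//.
have hF := csummable_le (Fb x) hb.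
rewrite -csumB//; last first.
  apply: csummable_le hb => n.
  by case: ifP => _; rewrite ?normr0// ger0_norm.
apply: le_trans (ltW hr); apply: ler_norm_csum.
  by move=> n /=; case: ifP; rewrite ?subrr ?normr0 ?subr0.
apply: csummable_le hb => n.
by case: ifP => _; rewrite ?normr0// ger0_norm.
Qed.

End Continuity.

Lemma dist_ext (R : realType) (S : choiceType) (d d' : dist R S) :
  d =1 d' -> d = d'.
Proof.
move=> /funext; case: d d' => f f0 f1 [g g0 g1] /= e; subst g.
by congr Dist; exact: Prop_irrelevance.
Qed.

(** * Binary distributions parametrized by a real number *)

Section BernoulliStrategies.
Variable R : realType.

Lemma mass_le1 (d : dist R bool) a : d a <= 1.
Proof.
have := mass_true_false d; have := mass_ge0 d true; have := mass_ge0 d false.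
by case: a; lra.
Qed.

Lemma dist_bool_ext (d d' : dist R bool) : d true = d' true -> d = d'.
Proof.
move=> e; apply: dist_ext => -[]//; have := mass_true_false d'.
by rewrite -(mass_true_false d) e => /addrI.
Qed.

(** Projection onto the unit interval. It lets [bern] accept every real and stay continuous, so that
    plans can be coded by families of reals. *)
Definition clip (x : R) := Num.max 0 (Num.min 1 x).

Lemma clip_itv x : 0 <= clip x <= 1.
Proof. by rewrite /clip le_max lexx/= ge_max ler01 ge_min lexx. Qed.

Lemma clip_id x : 0 <= x <= 1 -> clip x = x.
Proof. by case/andP=> x0 x1; rewrite /clip min_r// max_r. Qed.

Definition bern_mass (x : R) (a : bool) := if a then clip x else 1 - clip x.

Lemma bern_mass_ge0 x a : 0 <= bern_mass x a.
Proof. by have /andP[] := clip_itv x; case: a => /=; rewrite ?subr_ge0. Qed.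

Lemma bern_mass_sum1 x : (\esum_(a in [set: bool]) (bern_mass x a)%:E = 1)%E.
Proof.
rewrite esum_finType; last exact: bern_mass_ge0.
by rewrite big_bool/= addrC subrK.
Qed.

Definition bern x : dist R bool := Dist (bern_mass_ge0 x) (bern_mass_sum1 x).

Lemma bern_true (d : dist R bool) : bern (d true) = d.
Proof. by apply: dist_bool_ext; rewrite /= clip_id// mass_ge0 mass_le1. Qed.

Lemma continuous_bern (T : topologicalType) (f : T -> R) a :
  continuous f -> continuous (fun x => bern (f x) a).
Proof.
move=> cf; have cc : continuous (fun x => clip (f x)).
  apply: continuous_maxr; first exact: continuous_cstr.
  by apply: continuous_minr => //; exact: continuous_cstr.
case: a => //=; apply: continuous_addr; first exact: continuous_cstr.
exact: continuous_oppr.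
Qed.

End BernoulliStrategies.

(** * Unnormalized summary beliefs *)

Section BestReply.
Variables (R : realType) (g : bool -> R).

Lemma bestE a : best g a = (g (~~ a) <= g a).
Proof.
apply/forallP/idP => [|h b]; first exact.
by case: a b h => -[].
Qed.

(** The distribution [gamma] charges only maximizers, so the mean score is the maximum, ties
    included. [gamma] jumps with the belief, but this maximum is continuous in it. *)
Lemma sum_gamma_max : \sum_(w : bool) gamma g w * g w = Num.max (g true) (g false).
Proof.
rewrite /gamma; have -> : #|[pred b | best g b]| = (best g true + best g false)%N.
  rewrite -sum1_card big_mkcond big_bool /= !inE.
  by case: (best g true); case: (best g false).
rewrite big_bool /= !bestE /=.
case: (ltgtP (g true) (g false)) => h; rewrite ?add0n ?addn0 ?divr1 ?mul0r ?mul1r.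
- by rewrite add0r.
- by rewrite addr0.
- rewrite h -mulrDl; have -> : (true + true)%N = 2 by [].
  by lra.
Qed.

End BestReply.

Section Unnormalized.
Variables (R : realType) (p : R) (hp : 0 < p < 2^-1).
Implicit Types (mu b : int -> R) (th : sstrat R).

Lemma Qy_ge0 y w : 0 <= Qy p y w.
Proof. exact/ltW/Qy_gt0. Qed.

Lemma Qy_le1 y w : Qy p y w <= 1.
Proof. by case/andP: hp => p0 p1; rewrite /Qy; case: ifP => _; lra. Qed.

Lemma q_le1 w n : q p w n <= 1.
Proof.
have := q_sum1 hp n; have := q_ge0 hp true n; have := q_ge0 hp false n.
by case: w; lra.
Qed.

Lemma Qy_q_norm_le y w n (c s : R) :
  `|s| <= 1 -> `|Qy p y w * c * q p w n * s| <= `|c|.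
Proof.
move=> s1; rewrite !normrM (ger0_norm (Qy_ge0 _ _)) (ger0_norm (q_ge0 hp _ _)).
rewrite (_ : _ * _ = `|c| * (Qy p y w * q p w n * `|s|)); last by ring.
rewrite ler_piMr// mulr_ile1 ?mulr_ge0 ?q_ge0 ?Qy_ge0//.
by rewrite mulr_ile1 ?q_ge0 ?Qy_ge0 ?q_le1 ?Qy_le1.
Qed.

Lemma sstrat_norm th n m a : `|th n m a| <= 1.
Proof. by rewrite ger0_norm ?mass_ge0 ?mass_le1. Qed.

Lemma sstratB_norm th n m m' a : `|th n m a - th n m' a| <= 1.
Proof.
have := mass_ge0 (th n m) a; have := mass_ge0 (th n m') a.
have := mass_le1 (th n m) a; have := mass_le1 (th n m') a.
by rewrite ler_norml => ? ? ? ?; apply/andP; split; lra.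
Qed.

(* The quantities of the summary-based problem extended to unnormalized
   beliefs; they become homogeneous of degree 1 in mu. *)
Definition utruth mu th y : R := \sum_(w : bool)
  csum (fun n : int => Qy p y w * mu n * q p w n * (th n y w - th n (~~ y) w)).

Definition score mu y a : R := Qy p y a * csum (fun k : int => mu k * q p a k).

Definition utax mu th : R := \sum_(y : bool) \sum_(w : bool)
  csum (fun n : int => Qy p y w * mu n * q p w n
                       * (th n y w - gamma (score mu y) w)).

Definition push mu a th (n : int) : R := \sum_(w : bool) \sum_(m : bool)
  mu (n - pm m) * q p w (n - pm m) * Qy p m w * th (n - pm m) m a.

Definition uact mu th a : R := csum (fun n : int => \sum_(w : bool) \sum_(m : bool)
  mu n * q p w n * Qy p m w * th n m a).

Definition finmeas mu := (forall n, 0 <= mu n) /\ csummable mu.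

Lemma finmeas_dist (eta : dist R int) : finmeas eta.
Proof.
split=> [n|]; first exact: mass_ge0.
rewrite /csummable /summable; under eq_esum do rewrite /= ger0_norm ?mass_ge0//.
by rewrite mass_sum1 ltry.
Qed.

Lemma csum_dist (eta : dist R int) : csum eta = 1.
Proof. by rewrite csum_ge0E ?mass_sum1// => n; exact: mass_ge0. Qed.

Lemma finmeasZ c mu : 0 <= c -> finmeas mu -> finmeas (fun n => c * mu n).
Proof.
by move=> c0 [m0 hm]; split; [move=> n; exact: mulr_ge0 | exact: csummableZ].
Qed.

Lemma csummable_norm mu : csummable mu -> csummable (fun n => `|mu n|).
Proof.
rewrite /csummable /summable /=.
by under [in X in _ -> X]eq_esum do rewrite normr_id.
Qed.

Lemma csummable_term mu (y w : bool) (s : int -> R) :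
  (forall n, `|s n| <= 1) -> csummable mu ->
  csummable (fun n => Qy p y w * mu n * q p w n * s n).
Proof.
by move=> s1 hm; apply: csummable_le (csummable_norm hm) => n; exact: Qy_q_norm_le.
Qed.

Lemma csummable_q mu w : csummable mu -> csummable (fun n => mu n * q p w n).
Proof.
move=> hm; apply: csummable_le (csummable_norm hm) => n.
by rewrite normrM (ger0_norm (q_ge0 hp _ _)) ler_piMr ?q_le1.
Qed.

Definition gain mu th : R := \sum_(y : bool) \sum_(w : bool)
  csum (fun n : int => Qy p y w * mu n * q p w n * th n y w).

(** The subtracted part is the mean score under [gamma], a maximum by [sum_gamma_max]. Continuity,
    boundedness and homogeneity of the tax are all read off this form. *)
Lemma utaxE mu th : csummable mu -> utax mu th =
  gain mu th - \sum_(y : bool) Num.max (score mu y true) (score mu y false).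
Proof.
move=> hm; rewrite -sumrB; apply: eq_bigr => y _.
rewrite -sum_gamma_max -sumrB; apply: eq_bigr => w _.
have hq := csummable_q w hm.
rewrite /score mulrA -csumZ//.
rewrite -csumB; last exact: csummableZ.
  by apply: eq_csum => n /=; ring.
by apply: csummable_term => // n; exact: sstrat_norm.
Qed.

Lemma score_bound mu y a : finmeas mu -> 0 <= score mu y a <= csum mu.
Proof.
move=> [m0 hm]; have h0 : 0 <= csum (fun k => mu k * q p a k).
  by apply: csum_ge0 => k; rewrite mulr_ge0 ?q_ge0.
rewrite mulr_ge0 ?Qy_ge0//= -[leRHS]mul1r ler_pM ?Qy_ge0 ?Qy_le1//.
apply: le_csum => //; first exact: csummable_q.
by move=> n; rewrite ler_piMr ?q_le1.
Qed.

Lemma utax_bound mu th : finmeas mu -> `|utax mu th| <= 4 * csum mu.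
Proof.
move=> hm; have [m0 sm] := hm; rewrite utaxE//.
have hg y w : 0 <= csum (fun n => Qy p y w * mu n * q p w n * th n y w) <= csum mu.
  rewrite csum_ge0/=; last first.
    by move=> n; rewrite !mulr_ge0 ?Qy_ge0 ?q_ge0 ?mass_ge0.
  apply: le_csum => //.
    by apply: csummable_term => // n; exact: sstrat_norm.
  move=> n; apply: le_trans (ler_norm _) _.
  by apply: le_trans (Qy_q_norm_le _ _ _ _ (sstrat_norm _ _ _ _)) _; rewrite ger0_norm.
have hx y : 0 <= Num.max (score mu y true) (score mu y false) <= csum mu.
  have /andP[a1 a2] := score_bound y true hm; have /andP[b1 b2] := score_bound y false hm.
  by rewrite le_max a1 ge_max a2 b2.
rewrite /gain !big_bool /=.
(* The gain has four terms and the maxima are two, each between 0 and the mass of [mu]: the tax lies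
   between -2 and 4 times the mass. *)
move: (hg true true) (hg true false) (hg false true) (hg false false) (hx true) (hx false).
do 6 (move=> /andP[? ?]); rewrite ler_norml; apply/andP; split; lra.
Qed.

(** The bound involves neither [th] nor [a], so a single summable family dominates the pushed
    beliefs of all plans at once, and it can be iterated. The factor 2 counts the two states. *)
Lemma push_norm_le mu b a th n : (forall k, `|mu k| <= b k) ->
  `|push mu a th n| <= 2 * b (n - 1) + 2 * b (n + 1).
Proof.
move=> hb; rewrite /push !big_bool /=.
have t w m : `|mu (n - pm m) * q p w (n - pm m) * Qy p m w * th (n - pm m) m a|
    <= b (n - pm m).
  apply: le_trans (hb _); have := Qy_q_norm_le m w (n - pm m) (mu (n - pm m))
    (sstrat_norm th (n - pm m) m a).
  by congr (`|_| <= _); ring.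
have := t true true; have := t true false; have := t false true; have := t false false.
rewrite /= opprK => h1 h2 h3 h4.
apply: le_trans (ler_normD _ _) _; apply: le_trans (lerD (ler_normD _ _) (ler_normD _ _)) _.
lra.
Qed.

Lemma csummable_push_bound b :
  csummable b -> csummable (fun n => 2 * b (n - 1) + 2 * b (n + 1)).
Proof.
move=> hb; apply: csummableD; apply: csummableZ; first exact: csummable_shift.
by have := csummable_shift (-1) hb; under eq_fun do rewrite opprK.
Qed.

Lemma finmeas_push mu a th : finmeas mu -> finmeas (push mu a th).
Proof.
move=> [m0 hm]; split=> [n|].
  by do 2 (apply: sumr_ge0 => ? _); rewrite !mulr_ge0 ?Qy_ge0 ?q_ge0 ?mass_ge0.
apply: (csummable_le (b := fun n => 2 * mu (n - 1) + 2 * mu (n + 1))) => [n|].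
  by apply: push_norm_le => k; rewrite ger0_norm.
exact: csummable_push_bound.
Qed.

(** For each message the push is a translate, and translation preserves total mass. *)
Lemma csum_push mu a th : finmeas mu -> csum (push mu a th) = uact mu th a.
Proof.
move=> [m0 hm].
pose G m n := \sum_(w : bool) mu n * q p w n * Qy p m w * th n m a.
have G0 m n : 0 <= G m n.
  by apply: sumr_ge0 => ? _; rewrite !mulr_ge0 ?Qy_ge0 ?q_ge0 ?mass_ge0.
have hG m : csummable (G m).
  apply: csummable_sum => w; rewrite (_ : (fun x => _) =
    (fun n => Qy p m w * mu n * q p w n * th n m a)); last by apply/funext => n; ring.
  by apply: csummable_term => // n; exact: sstrat_norm.
transitivity (csum (fun n => \sum_(m : bool) G m (n - pm m))).
  by apply: eq_csum => n; exact: exchange_big.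
transitivity (csum (fun n => \sum_(m : bool) G m n)); last first.
  by apply: eq_csum => n; exact: exchange_big.
rewrite !csum_sum//; last by move=> m; exact: csummable_shift.
by apply: eq_bigr => m _; rewrite csum_shift.
Qed.

(** Pointwise in [n], the kernels for state, message and action each sum to 1. *)
Lemma sum_uact mu th : finmeas mu -> \sum_(a : bool) uact mu th a = csum mu.
Proof.
move=> [m0 hm]; rewrite /uact -csum_sum; last first.
  move=> a; apply: csummable_sum => w; apply: csummable_sum => m.
  rewrite (_ : (fun x => _) =
    (fun n => Qy p m w * mu n * q p w n * th n m a)); last by apply/funext => n; ring.
  by apply: csummable_term => // n; exact: sstrat_norm.
apply: eq_csum => n; rewrite !big_bool.
have e2 w : Qy p false w = 1 - Qy p true w by rewrite -(Qy_sum1 p w) addrAC subrr add0r.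
have e1 : q p false n = 1 - q p true n by rewrite -(q_sum1 hp n) addrAC subrr add0r.
have e3 m : th n m false = 1 - th n m true.
  by rewrite -(mass_true_false (th n m)) addrAC subrr add0r.
rewrite !e3 !e2 e1; move: (q p true n) (Qy p true true) (Qy p true false).
move: (th n true true) (th n false true) (mu n).
by move=> * /=; ring.
Qed.

Lemma sum_csum_push mu th : finmeas mu ->
  \sum_(a : bool) csum (push mu a th) = csum mu.
Proof. by move=> hm; under eq_bigr do rewrite csum_push//; exact: sum_uact. Qed.

Lemma pushZ c mu a th : push (fun n => c * mu n) a th = fun n => c * push mu a th n.
Proof.
apply/funext => n; rewrite /push mulr_sumr; apply: eq_bigr => w _.
by rewrite mulr_sumr; apply: eq_bigr => m _; rewrite !mulrA.
Qed.

Lemma utruthZ c mu th y : csummable mu ->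
  utruth (fun n => c * mu n) th y = c * utruth mu th y.
Proof.
move=> hm; rewrite /utruth mulr_sumr; apply: eq_bigr => w _; rewrite -csumZ.
  by apply: eq_csum => n; ring.
by apply: csummable_term => // n; exact: sstratB_norm.
Qed.

Lemma scoreZ c mu y a : csummable mu ->
  score (fun n => c * mu n) y a = c * score mu y a.
Proof.
move=> hm; rewrite /score mulrCA; congr (_ * _).
rewrite -csumZ; last exact: csummable_q.
by apply: eq_csum => n; ring.
Qed.

Lemma utaxZ c mu th : 0 <= c -> csummable mu ->
  utax (fun n => c * mu n) th = c * utax mu th.
Proof.
move=> c0 hm; rewrite !utaxE//; last exact: csummableZ.
rewrite mulrBr; congr (_ - _).
  rewrite /gain mulr_sumr; apply: eq_bigr => y _.
  rewrite mulr_sumr; apply: eq_bigr => w _; rewrite -csumZ.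
    by apply: eq_csum => n; ring.
  by apply: csummable_term => // n; exact: sstrat_norm.
by rewrite mulr_sumr; apply: eq_bigr => y _; rewrite !scoreZ// maxr_pMr.
Qed.

Section Continuity.
Variables (T : topologicalType) (mu : T -> int -> R) (b : int -> R).
Variable th : T -> sstrat R.
Hypothesis hb : csummable b.
Hypothesis mub : forall x n, `|mu x n| <= b n.
Hypothesis cmu : forall n, continuous (mu ^~ n).
Hypothesis cth : forall n m a, continuous (fun x => th x n m a).

Let c_term y w n (s : T -> R) : continuous s ->
  continuous (fun x => Qy p y w * mu x n * q p w n * s x).
Proof.
move=> cs; do !apply: continuous_mulr => //; exact: continuous_cstr.
Qed.

Lemma continuous_utruth y : continuous (fun x => utruth (mu x) (th x) y).
Proof.
apply: continuous_sumr => w; apply: (continuous_csum hb).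
  move=> x n; apply: le_trans (mub x n); apply: Qy_q_norm_le; exact: sstratB_norm.
move=> n; apply: c_term; apply: continuous_addr => //; exact: continuous_oppr.
Qed.

Lemma continuous_score y a : continuous (fun x => score (mu x) y a).
Proof.
apply: continuous_mulr; first exact: continuous_cstr.
apply: (continuous_csum hb) => [x n|n]; last first.
  by apply: continuous_mulr => //; exact: continuous_cstr.
apply: le_trans (mub x n).
by rewrite normrM (ger0_norm (q_ge0 hp _ _)) ler_piMr ?q_le1.
Qed.

Lemma continuous_utax : continuous (fun x => utax (mu x) (th x)).
Proof.
rewrite (_ : (fun x => _) = fun x => gain (mu x) (th x) -
  \sum_(y : bool) Num.max (score (mu x) y true) (score (mu x) y false)); last first.
  by apply/funext => x; apply: utaxE; exact: csummable_le hb.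
apply: continuous_addr.
  apply: continuous_sumr => y; apply: continuous_sumr => w.
  apply: (continuous_csum hb) => [x n|n]; last exact: c_term.
  apply: le_trans (mub x n); apply: Qy_q_norm_le; exact: sstrat_norm.
apply: continuous_oppr; apply: continuous_sumr => y.
by apply: continuous_maxr; exact: continuous_score.
Qed.

Lemma continuous_push a n : continuous (fun x => push (mu x) a (th x) n).
Proof.
apply: continuous_sumr => w; apply: continuous_sumr => m.
by do !apply: continuous_mulr => //; exact: continuous_cstr.
Qed.

End Continuity.

End Unnormalized.

(** * Contingent plans and the Bellman equation *)

Lemma geometric_small (R : realType) (c d e : R) : 0 < d < 1 -> 0 < e ->
  exists k, c * d ^+ k <= e.
Proof.
move=> /andP[d0 d1] e0.
have : geometric c d @ \oo --> 0 by apply: cvg_geometric; rewrite ger0_norm// ltW.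
move=> /cvgrPdist_lt/(_ e e0)[k _ /(_ k (leqnn k))] /=.
rewrite sub0r normrN => hk; exists k.
exact: le_trans (ler_norm _) (ltW hk).
Qed.

(** Comparison with a geometric series. The error depends on [c], [d] and [k] alone, hence is
    uniform over plans or over sample points in the applications. *)
Lemma cvg_lim_geometric (R : realType) (u : nat -> R) (c d : R) :
  0 < d < 1 -> u 0 = 0 -> (forall k, `|u k.+1 - u k| <= c * d ^+ k) ->
  cvgn u /\ forall k, `|limn u - u k| <= c / (1 - d) * d ^+ k.
Proof.
move=> /[dup] d01 /andP[d0 d1] u0 hu.
have c0 : 0 <= c by have := le_trans (normr_ge0 _) (hu 0); rewrite expr0 mulr1.
have diff k m : `|u (k + m)%N - u k| <= c / (1 - d) * d ^+ k.
  have dm j : 0 <= d ^+ j by rewrite exprn_ge0// ltW.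
  (* This is the exact partial geometric sum, for which the induction step on [m] closes with
     equality. *)
  suff : `|u (k + m)%N - u k| <= c / (1 - d) * d ^+ k * (1 - d ^+ m).
    move=> /le_trans; apply; rewrite ler_piMr ?gerBl//.
    by rewrite !mulr_ge0// invr_ge0; lra.
  elim: m => [|m IH]; first by rewrite addn0 subrr normr0 expr0 subrr mulr0.
  rewrite addnS -(subrKA (u (k + m)%N)).
  apply: le_trans (ler_normD _ _) _; apply: le_trans (lerD (hu _) IH) _.
  rewrite -subr_ge0 exprD exprS; set X := (X in 0 <= X).
  suff -> : X = 0 by [].
  by rewrite /X; field; lra.
have cv : cvgn u.
  apply/cauchy_cvgP/cauchy_exP => _/posnumP[e].
  have e2 : 0 < e%:num / 2 :> R by rewrite divr_gt0.
  have [N hN] := geometric_small (c / (1 - d)) d01 e2.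
  exists (u N); exists N => //= k Nk; rewrite /ball/= distrC -(subnKC Nk).
  apply: le_lt_trans (diff _ _) (le_lt_trans hN _).
  by rewrite ltr_pdivrMr// ltr_pMr// ltr1n.
split=> // k; rewrite ler_distl; apply/andP; split.
- apply: limr_ge => //; exists k => //= j kj.
  have := diff k (j - k)%N; rewrite subnKC// ler_distl => /andP[//].
- apply: limr_le => //; exists k => //= j kj.
  have := diff k (j - k)%N; rewrite subnKC// ler_distl => /andP[//].
Qed.

Section Trees.
Variables (R : realType) (p : R) (hp : 0 < p < 2^-1).
Variables (delta : R) (hdelta : 0 < delta < 1).
Implicit Types (mu b : int -> R) (th : sstrat R).

(* A contingent plan: the summary-based partial strategy to be used after each
   finite sequence of actions, oldest action first. *)
Definition plan := seq bool -> sstrat R.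
Implicit Types psi : plan.

Definition subplan psi a : plan := fun s => psi (a :: s).

(** The unnormalized belief reached after the actions [s]; if [mu] has mass 1, its mass is the
    probability of [s]. *)
Fixpoint node mu psi (s : seq bool) : int -> R :=
  if s is a :: s' then node (push p mu a (psi [::])) (subplan psi a) s' else mu.

(** Imposed at every node: at one of probability zero the measure vanishes and the constraint holds
    trivially. *)
Definition pfeasible mu psi : Prop :=
  forall s y, 0 <= utruth p (node mu psi s) (psi s) y.

Lemma pfeasibleE mu psi : pfeasible mu psi <->
  (forall y, 0 <= utruth p mu (psi [::]) y) /\
  forall a, pfeasible (push p mu a (psi [::])) (subplan psi a).
Proof.
split=> [h|[h0 h1] [|a s] y]; [|exact: h0|exact: h1].
by split=> [y|a s y]; [exact: (h [::]) | exact: (h (a :: s))].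
Qed.

(** Value truncated after [k] periods. The sum over actions carries no weights, because the mass of
    each push already is the probability of the action. *)
Fixpoint pvalue_n k mu psi : R :=
  if k is k'.+1 then utax p mu (psi [::]) + delta *
    \sum_(a : bool) pvalue_n k' (push p mu a (psi [::])) (subplan psi a)
  else 0.

Definition pvalue mu psi : R := limn (fun k => pvalue_n k mu psi).

(** Two successive truncations differ only in the tax of period [k], at most 4 times the mass there,
    and pushing preserves total mass. *)
Lemma pvalue_n_diff k mu psi : finmeas mu ->
  `|pvalue_n k.+1 mu psi - pvalue_n k mu psi| <= 4 * csum mu * delta ^+ k.
Proof.
case/andP: hdelta => d0 d1.
elim: k mu psi => [|k IH] mu psi hm.
  rewrite /= big1// mulr0 addr0 subr0 expr0 mulr1; exact: utax_bound.
have dB (x y z : R) : (x + y) - (x + z) = y - z by ring.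
have -> : pvalue_n k.+2 mu psi - pvalue_n k.+1 mu psi = delta * \sum_(a : bool)
    (pvalue_n k.+1 (push p mu a (psi [::])) (subplan psi a)
     - pvalue_n k (push p mu a (psi [::])) (subplan psi a)).
  by rewrite sumrB mulrBr; exact: dB.
rewrite normrM gtr0_norm// exprS mulrCA ler_pM2l//.
apply: le_trans (ler_norm_sum _ _ _) _.
rewrite -(sum_csum_push hp (psi [::]) hm) mulr_sumr mulr_suml.
by apply: ler_sum => a _; apply: IH; exact: finmeas_push.
Qed.

Lemma pvalue_approx k mu psi : finmeas mu ->
  `|pvalue mu psi - pvalue_n k mu psi| <= 4 * csum mu / (1 - delta) * delta ^+ k.
Proof.
move=> hm.
by have [_] := cvg_lim_geometric hdelta erefl (fun j => pvalue_n_diff j psi hm).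
Qed.

Lemma cvg_pvalue mu psi : finmeas mu ->
  (fun k => pvalue_n k mu psi) @ \oo --> pvalue mu psi.
Proof.
move=> hm.
by have [h _] := cvg_lim_geometric hdelta erefl (fun j => pvalue_n_diff j psi hm).
Qed.

Lemma pvalue_bound mu psi : finmeas mu ->
  `|pvalue mu psi| <= 4 * csum mu / (1 - delta).
Proof. by move=> hm; have := pvalue_approx 0 psi hm; rewrite subr0 expr0 mulr1. Qed.

Lemma pvalueE mu psi : finmeas mu -> pvalue mu psi =
  utax p mu (psi [::]) + delta *
    \sum_(a : bool) pvalue (push p mu a (psi [::])) (subplan psi a).
Proof.
move=> hm; apply/cvg_lim => //; rewrite -(cvg_shiftn 1) /=.
under eq_fun do rewrite addn1 /= big_bool /=.
rewrite big_bool /=; apply: cvgD; first exact: cvg_cst.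
by apply: cvgMl_tmp; apply: cvgD; apply: cvg_pvalue; exact: finmeas_push.
Qed.

Lemma pvalueZ c mu psi : 0 <= c -> finmeas mu ->
  pvalue (fun n => c * mu n) psi = c * pvalue mu psi.
Proof.
move=> c0 hm; apply/cvg_lim => //.
suff -> : (fun k => pvalue_n k (fun n => c * mu n) psi) =
          (fun k => c * pvalue_n k mu psi).
  by apply: cvgMl_tmp; exact: cvg_pvalue.
apply/funext => k; elim: k mu psi hm => [|k IH] mu psi hm; first by rewrite /= mulr0.
rewrite /= utaxZ//; last by case: hm.
rewrite mulrDr mulrCA; congr (_ + delta * _); rewrite mulr_sumr.
by apply: eq_bigr => a _; rewrite pushZ IH//; exact: finmeas_push.
Qed.

Lemma nodeZ c mu psi s :
  node (fun n => c * mu n) psi s = fun n => c * node mu psi s n.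
Proof. by elim: s mu psi => [//|a s IH] mu psi /=; rewrite pushZ IH. Qed.

Lemma finmeas_node mu psi s : finmeas mu -> finmeas (node mu psi s).
Proof.
elim: s mu psi => [//|a s IH] mu psi hm /=; apply: IH; exact: finmeas_push.
Qed.

Lemma pfeasibleZ c mu psi : 0 <= c -> finmeas mu ->
  pfeasible mu psi -> pfeasible (fun n => c * mu n) psi.
Proof.
move=> c0 hm h s y; rewrite nodeZ utruthZ// ?mulr_ge0//.
by case: (finmeas_node psi s hm).
Qed.

Section Continuity.
Variable T : topologicalType.
Implicit Types (m : T -> int -> R) (f : T -> plan).

(** The starting measure also varies with [x], since after one push it depends on the plan; the
    dominating family is replaced along with it in the induction. *)
Lemma continuous_pvalue_n k m f b : csummable b ->
  (forall x n, `|m x n| <= b n) -> (forall n, continuous (m ^~ n)) ->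
  (forall s n y a, continuous (fun x => f x s n y a)) ->
  continuous (fun x => pvalue_n k (m x) (f x)).
Proof.
elim: k m f b => [|k IH] m f b hb mb cm cf; first exact: continuous_cstr.
apply: continuous_addr; first by apply: (continuous_utax hp hb).
apply: continuous_mulr; first exact: continuous_cstr.
apply: continuous_sumr => a; apply: (IH _ _ _ (csummable_push_bound hb)).
- by move=> x n; apply: push_norm_le.
- by move=> n; exact: continuous_push.
- by move=> s n y a'; exact: cf.
Qed.

Lemma continuous_node_utruth m f b s y : csummable b ->
  (forall x n, `|m x n| <= b n) -> (forall n, continuous (m ^~ n)) ->
  (forall s n y a, continuous (fun x => f x s n y a)) ->
  continuous (fun x => utruth p (node (m x) (f x) s) (f x s) y).
Proof.
elim: s m f b => [|a s IH] m f b hb mb cm cf.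
  by apply: (continuous_utruth hp hb).
apply: (IH _ (fun x => subplan (f x) a) _ (csummable_push_bound hb)).
- by move=> x n; apply: push_norm_le.
- by move=> n; exact: continuous_push.
- by move=> s' n y' a'; exact: cf.
Qed.

(** The truncations are continuous and converge uniformly over all plans. *)
Lemma continuous_pvalue mu f : finmeas mu ->
  (forall s n y a, continuous (fun x => f x s n y a)) ->
  continuous (fun x => pvalue mu (f x)).
Proof.
move=> hm cf; apply: continuous_uniform_approx => e e0.
have [N hN] := geometric_small (4 * csum mu / (1 - delta)) hdelta e0.
exists (fun x => pvalue_n N mu (f x)).
  case: hm => m0 hm; apply: (@continuous_pvalue_n N (fun=> mu) f mu hm) => //.
    by move=> x n; rewrite ger0_norm.
  by move=> n; exact: continuous_cstr.
by move=> x; exact: le_trans (pvalue_approx _ _ hm) hN.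
Qed.

End Continuity.

(* Plans form a compact space (Tychonoff) on which the value is continuous and
   the truth-telling constraints are closed. *)
Lemma optimal_plan mu : finmeas mu ->
  exists2 psi, pfeasible mu psi &
    forall psi', pfeasible mu psi' -> pvalue mu psi' <= pvalue mu psi.
Proof.
move=> hm.
(* One real coordinate per action sequence, summary and message: the probability of playing action
   1. *)
pose I : choiceType := (seq bool * int * bool)%type.
pose X : topologicalType := prod_topology (fun _ : I => R).
pose f (x : X) : plan := fun s n m => bern (x (s, n, m)).
pose K : set X := [set x | forall i, `[0, 1]%classic (x i)].
have cf s n y a : continuous (fun x => f x s n y a).
  by apply: continuous_bern; exact: (@proj_continuous I (fun=> R) (s, n, y)).
have cK : compact K by apply: (@tychonoff I (fun=> R) (fun=> `[0, 1]%classic)) => i;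
    exact: segment_compact.
pose F : set X := K `&` [set x | pfeasible mu (f x)].
have clF : closed [set x | pfeasible mu (f x)].
  (* One condition per node and message, each the preimage of a closed half-line under a continuous
     map. *)
  rewrite (_ : [set x | _] = \bigcap_(i in [set: seq bool * bool])
     ((fun x => utruth p (node mu (f x) i.1) (f x i.1) i.2) @^-1` [set r | 0 <= r])).
    apply: closed_bigI => i _; apply: preimage_closed; last exact: closed_ge.
    move=> x _; case: hm => m0 hm.
    apply: (@continuous_node_utruth _ (fun=> mu) f mu i.1 i.2 hm) => //.
      by move=> x' n; rewrite ger0_norm.
    by move=> n; exact: continuous_cstr.
  apply/seteqP; split=> [x h [s y] _|x h s y]; [exact: h | exact: (h (s, y))].
have cF : compact F.
  by rewrite /F; apply: compact_closedI.
have F0 : F !=set0.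
  (* This plan ignores the message, so every truth-telling constraint is an equality. *)
  exists (fun=> 0); split; first by move=> i /=; rewrite in_itv /= lexx ler01.
  move=> s y; rewrite /utruth big1// => w _.
  by rewrite (eq_csum (g := fun=> 0)) ?csum0// => n; rewrite subrr mulr0.
have [x + xmax] := compact_EVT_max F0 cF
   (continuous_subspaceT (continuous_pvalue hm cf)).
rewrite inE => -[_ Fx]; exists (f x) => // psi' h'.
pose x' : X := fun i => psi' i.1.1 i.1.2 i.2 true.
have e : f x' = psi'.
  by apply/funext => s; apply/funext => n; apply/funext => m; exact: bern_true.
rewrite -[in leLHS]e; apply: xmax; rewrite inE; split; last by rewrite /= e.
by move=> i /=; rewrite in_itv/= mass_ge0 mass_le1.
Qed.

Definition best_plan mu : plan :=
  if pselect (finmeas mu) is left hm then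
    projT1 (cid2 (optimal_plan hm)) else fun _ _ _ => bern 0.

Lemma best_planP mu : finmeas mu -> pfeasible mu (best_plan mu) /\
  forall psi, pfeasible mu psi -> pvalue mu psi <= pvalue mu (best_plan mu).
Proof.
by move=> hm; rewrite /best_plan; case: pselect => // h; case: cid2.
Qed.

Definition uvalue mu : R := pvalue mu (best_plan mu).

Lemma uvalue_bound mu : finmeas mu -> `|uvalue mu| <= 4 * csum mu / (1 - delta).
Proof. exact: pvalue_bound. Qed.

(** For [c > 0] the measures [mu] and [c * mu] have the same feasible plans, so each best plan
    competes with the other after rescaling; [c = 0] is treated apart. *)
Lemma uvalueZ c mu : 0 <= c -> finmeas mu ->
  uvalue (fun n => c * mu n) = c * uvalue mu.
Proof.
move=> c0 hm; have hcm := finmeasZ c0 hm.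
have [fm mm] := best_planP hm; have [fc mc] := best_planP hcm.
have [->|cN0] := eqVneq c 0.
  by rewrite mul0r /uvalue pvalueZ ?mul0r.
have cp : 0 < c by rewrite lt_neqAle eq_sym cN0.
apply/eqP; rewrite eq_le; apply/andP; split; last first.
  by rewrite /uvalue -[leLHS]pvalueZ//; apply: mc; exact: pfeasibleZ.
rewrite /uvalue pvalueZ// ler_pM2l//; apply: mm.
have ci0 : 0 <= c^-1 by rewrite invr_ge0.
have := pfeasibleZ ci0 hcm fc.
by under eq_fun do rewrite mulrA mulVf// mul1r.
Qed.

Definition ubellman mu th : R :=
  utax p mu th + delta * \sum_(a : bool) uvalue (push p mu a th).

(** The left side is the value of the feasible plan that starts with [th] and follows a best plan
    after each action. *)
Lemma ubellman_le mu th : finmeas mu -> (forall y, 0 <= utruth p mu th y) ->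
  ubellman mu th <= uvalue mu.
Proof.
move=> hm hth; have [_ +] := best_planP hm.
pose psi : plan := fun s => if s is a :: s' then best_plan (push p mu a th) s' else th.
move=> /(_ psi); rewrite pvalueE//; apply; apply/pfeasibleE; split=> // a.
by have [] := best_planP (finmeas_push hp a th hm).
Qed.

(** The continuations of a best plan are feasible from the pushed beliefs, hence worth at most the
    best plans there. *)
Lemma ubellman_eq mu : finmeas mu ->
  (forall y, 0 <= utruth p mu (best_plan mu [::]) y) /\
  ubellman mu (best_plan mu [::]) = uvalue mu.
Proof.
move=> hm; have [/pfeasibleE[h0 h1] _] := best_planP hm; split=> //.
apply/eqP; rewrite eq_le ubellman_le//= /uvalue pvalueE// lerD2l.
case/andP: hdelta => d0 d1; rewrite ler_pM2l//; apply: ler_sum => a _.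
by have [_] := best_planP (finmeas_push hp a (best_plan mu [::]) hm); apply.
Qed.

(** Ties the unnormalized push to the normalized update. If the action has probability zero, the
    push is a nonnegative measure of mass 0 and vanishes, whatever [supdate] returns. *)
Lemma push_supdate (eta : dist R int) a th :
  push p eta a th = fun n => act_prob p eta th a * supdate hp eta a th n.
Proof.
have hm := finmeas_dist eta; apply/funext => n /=; rewrite /supdate_mass.
case: eqP => [h|/eqP h]; last by rewrite mulrCA divff ?mulr1.
rewrite h mul0r; apply/eqP; rewrite eq_le.
have [m0 sm] := finmeas_push hp a th hm; rewrite m0 andbT.
have s0 : csum (push p eta a th) = 0 by rewrite csum_push.
rewrite -s0 -{1}(csum_delta n (push p eta a th n)).
apply: le_csum => //; first exact: csummable_delta.
by move=> k; case: eqP => [->|].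
Qed.

Definition svalue (eta : dist R int) : R := uvalue eta.

(** Only the first prescription of a best plan is kept; choosing a new best plan at each new summary
    belief makes the strategy stationary. *)
Definition spolicy (eta : dist R int) : sstrat R := best_plan eta [::].

(** Homogeneity moves the action probability inside the value, turning the expected continuation
    into values of pushes. *)
Lemma bellmanE (eta : dist R int) th :
  bellman hp delta svalue eta th = ubellman eta th.
Proof.
rewrite /bellman /ubellman; congr (_ + delta * _); apply: eq_bigr => a _.
rewrite push_supdate uvalueZ//; first exact: act_prob_ge0.
exact: finmeas_dist.
Qed.

Lemma bellman_le (eta : dist R int) th : struthful p eta th ->
  bellman hp delta svalue eta th <= svalue eta.
Proof. by move=> h; rewrite bellmanE; apply: ubellman_le => //; exact: finmeas_dist. Qed.

Lemma bellman_spolicy (eta : dist R int) : struthful p eta (spolicy eta) /\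
  bellman hp delta svalue eta (spolicy eta) = svalue eta.
Proof. by rewrite bellmanE; apply: ubellman_eq; exact: finmeas_dist. Qed.

Lemma svalue_bound eta : `|svalue eta| <= 4 / (1 - delta).
Proof.
by have := uvalue_bound (finmeas_dist eta); rewrite csum_dist mulr1.
Qed.

End Trees.

(** * From histories to summaries *)

Lemma past_cons t b (x : t.-tuple bool) : past [tuple of b :: x] = x.
Proof. exact: val_inj. Qed.

Lemma cons_past t (x : t.+1.-tuple bool) : x = [tuple of thead x :: past x].
Proof. by case/tupleP: x => b x; rewrite theadE past_cons. Qed.

Lemma big_tuple0 (V : nmodType) (F : 0.-tuple bool -> V) :
  \sum_(m : 0.-tuple bool) F m = F [tuple].
Proof.
rewrite (bigD1 [tuple])//= big1 ?addr0// => m.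
by rewrite (tuple0 m) => /eqP[].
Qed.

Lemma big_tupleS (V : nmodType) t (F : t.+1.-tuple bool -> V)
    (P : pred (t.+1.-tuple bool)) :
  \sum_(m | P m) F m =
  \sum_(y : bool) \sum_(m : t.-tuple bool | P [tuple of y :: m]) F [tuple of y :: m].
Proof.
rewrite (reindex (fun u : bool * t.-tuple bool => [tuple of u.1 :: u.2])) /=.
  by rewrite -(pair_big_dep xpredT (fun (y : bool) (m : t.-tuple bool) => P [tuple of y :: m])
    (fun y m => F [tuple of y :: m])).
exists (fun m => (thead m, past m)) => [[y m] _|m _]; first by rewrite theadE past_cons.
by rewrite /= -cons_past.
Qed.

Lemma msum_cons t b (x : t.-tuple bool) : msum [tuple of b :: x] = pm b + msum x.
Proof.
rewrite /msum big_ord_recl tnth0; congr (_ + _).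
by apply: eq_bigr => i _; rewrite tnthS.
Qed.

Section Reduction.
Variables (R : realType) (p : R) (hp : 0 < p < 2^-1).
Variables (t : nat) (pi : dist R (t.-tuple bool)).

(* th is the conditional expectation of theta given the summary. *)
Definition averages (theta : strat R t) (th : sstrat R) : Prop :=
  forall n y a, summary_mass pi n * th n y a =
    \sum_(m : t.-tuple bool | msum m == n) pi m * theta [tuple of y :: m] a.

Lemma averages_exists theta : exists th, averages theta th.
Proof.
pose s n y := \sum_(m | msum m == n) pi m * theta [tuple of y :: m] true.
exists (fun n y => bern (s n y / summary_mass pi n)) => n y a.
have s0 : 0 <= s n y by apply: sumr_ge0 => m _; rewrite mulr_ge0 ?mass_ge0.
have s1 : s n y <= summary_mass pi n.
  by apply: ler_sum => m _; rewrite ler_piMr ?mass_ge0 ?mass_le1.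
have eta0 : 0 <= summary_mass pi n by exact: le_trans s1.
have sF : \sum_(m | msum m == n) pi m * theta [tuple of y :: m] false =
    summary_mass pi n - s n y.
  rewrite /summary_mass -sumrB; apply: eq_bigr => m _.
  rewrite -[X in _ = X - _]mulr1 -(mass_true_false (theta [tuple of y :: m])).
  by rewrite mulrDr addrAC subrr add0r.
(* At a summary of mass zero both sides of the identity vanish, so the junk quotient does no
   harm. *)
have [e0|eN0] := eqVneq (summary_mass pi n) 0.
  have sn0 : s n y = 0 by apply/eqP; rewrite eq_le s0 andbT -e0.
  by rewrite e0 mul0r; case: a; rewrite -?/(s n y) ?sF sn0 ?e0 ?subrr.
rewrite /= /bern_mass clip_id; last first.
  by rewrite divr_ge0//= ler_pdivrMr ?mul1r// lt_neqAle eq_sym eN0.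
case: a; rewrite ?sF; first by rewrite mulrCA divff ?mulr1.
by rewrite mulrBr mulr1 mulrCA divff ?mulr1.
Qed.

Lemma averages_summary (th : sstrat R) (theta : strat R t) :
  (forall m, theta m = th (msum (past m)) (thead m)) -> averages theta th.
Proof.
move=> h n y a; rewrite /summary_mass mulr_suml; apply: eq_bigr => m /eqP <-.
by rewrite h past_cons theadE.
Qed.

Variables (theta : strat R t) (th : sstrat R).
Hypothesis hth : averages theta th.

Lemma csum_summary (c : int -> R) :
  csum (fun n => summary pi n * c n) = \sum_m pi m * c (msum m).
Proof.
rewrite -(csum_fiber (@msum t)); apply: eq_csum => n.
by rewrite /= /summary_mass mulr_suml; apply: eq_bigr => m /eqP ->.
Qed.

Lemma csum_averages (c : int -> R) y a :
  csum (fun n => c n * (summary pi n * th n y a)) =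
  \sum_m c (msum m) * (pi m * theta [tuple of y :: m] a).
Proof.
rewrite -(csum_fiber (@msum t)); apply: eq_csum => n.
by rewrite /= hth mulr_sumr; apply: eq_bigr => m /eqP ->.
Qed.

Let csummable_averages (c : int -> R) y a : (forall n, `|c n| <= 1) ->
  csummable (fun n => c n * (summary pi n * th n y a)).
Proof.
move=> hc; apply: (csummable_le (b := summary pi)); last first.
  by case: (finmeas_dist (summary pi)).
move=> n; rewrite normrM (ger0_norm (mulr_ge0 _ _)) ?mass_ge0//.
rewrite -[leRHS]mul1r ler_pM// ?mulr_ge0 ?mass_ge0//.
by rewrite ler_piMr ?mass_ge0 ?mass_le1.
Qed.

Let Qyq_le1 y w n : `|Qy p y w * q p w n| <= 1.
Proof.
have h1 : `|1 : R| <= 1 by rewrite normr1.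
by have := Qy_q_norm_le hp y w n 1 h1; rewrite !mulr1 normr1.
Qed.

(** The constraints are linear in [theta], and apart from [pi] the coefficients see the history only
    through its sum. *)
Lemma truthful_summary : truthful p pi theta <-> struthful p (summary pi) th.
Proof.
suff E y w : \sum_(m : t.-tuple bool) Qy p y w * q p w (msum m) * pi m
           * (theta [tuple of y :: m] w - theta [tuple of ~~ y :: m] w) =
   csum (fun n : int => Qy p y w * summary pi n * q p w n
                                * (th n y w - th n (~~ y) w)).
  by split=> h y; have := h y; rewrite (eq_bigr _ (fun w _ => E y w)).
rewrite (eq_csum (g :=
   (fun n => Qy p y w * q p w n * (summary pi n * th n y w)) \-
   (fun n => Qy p y w * q p w n * (summary pi n * th n (~~ y) w)))); last first.
  by move=> n /=; ring.
rewrite csumB; [|exact: csummable_averages..].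
rewrite (csum_averages (fun n => Qy p y w * q p w n)).
rewrite (csum_averages (fun n => Qy p y w * q p w n)) -sumrB.
by apply: eq_bigr => m _; ring.
Qed.

(** Same linearity, once the scores that determine [gamma] are seen to depend on [pi] only through
    its summary. *)
Lemma tax_summary : tax p pi theta = stax p (summary pi) th.
Proof.
have eg y : (fun a => Qy p y a * \sum_(k : t.-tuple bool) q p a (msum k) * pi k)
    = (fun a => Qy p y a * csum (fun k : int => summary pi k * q p a k)).
  apply/funext => a; rewrite csum_summary; congr (_ * _).
  by apply: eq_bigr => m _; rewrite mulrC.
apply: eq_bigr => y _; apply: eq_bigr => w _; rewrite eg.
set G := gamma _ w.
have cq : csummable (fun n : int => summary pi n * (Qy p y w * q p w n)).
  apply: (csummable_le (b := summary pi)); last by case: (finmeas_dist (summary pi)).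
  by move=> n; rewrite normrM ger0_norm ?mass_ge0// ler_piMr ?mass_ge0.
rewrite (eq_csum (g :=
   (fun n => Qy p y w * q p w n * (summary pi n * th n y w)) \-
   (fun n => G * (summary pi n * (Qy p y w * q p w n))))); last first.
  by move=> n /=; ring.
rewrite csumB; [|exact: csummable_averages|exact: csummableZ].
rewrite csumZ// (csum_summary (fun n => Qy p y w * q p w n)).
rewrite (csum_averages (fun n => Qy p y w * q p w n)) mulr_sumr -sumrB.
by apply: eq_bigr => m _; ring.
Qed.

(** Histories of sum [n] are grouped by their latest message [y], which leaves earlier histories of
    sum [n - pm y]. *)
Lemma sum_belief_num a n : \sum_(m | msum m == n) belief_num p pi a theta m =
  summary_num p (summary pi) a th n.
Proof.
rewrite big_tupleS /summary_num exchange_big; apply: eq_bigr => y _.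
rewrite exchange_big; apply: eq_bigr => w _ /=.
rewrite (_ : _ * _ = q p w (n - pm y) * Qy p y w *
  (summary_mass pi (n - pm y) * th (n - pm y) y a)); last by rewrite /=; ring.
rewrite hth mulr_sumr; apply: eq_big => m.
  by rewrite msum_cons [in RHS]eq_sym subr_eq eq_sym addrC.
by rewrite msum_cons => /eqP <-; rewrite past_cons theadE addrAC subrr add0r; ring.
Qed.

Lemma belief_den_summary a :
  belief_den p pi a theta = act_prob p (summary pi) th a.
Proof.
rewrite /belief_den -(csum_fiber (@msum t.+1)).
under eq_csum do rewrite sum_belief_num.
by rewrite [LHS](csum_push hp)//; exact: finmeas_dist.
Qed.

(** Stated for positive probability because the two conventions differ: the belief becomes a point
    mass, while the summary belief stays unchanged. *)
Lemma summary_update a : belief_den p pi a theta != 0 ->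
  summary (update hp pi a theta) = supdate hp (summary pi) a th.
Proof.
move=> d0; apply: dist_ext => n /=; rewrite /supdate_mass /summary_mass.
rewrite -belief_den_summary (negPf d0) -sum_belief_num mulr_suml.
by apply: eq_bigr => m _ /=; rewrite /belief_mass (negPf d0).
Qed.

End Reduction.

(** * Optimality *)

Section Paths.
Variables (R : realType) (p : R) (hp : 0 < p < 2^-1) (phi : policy R).

Fixpoint act_path_prob t : t.-tuple bool -> R :=
  match t with
  | 0 => fun=> 1
  | s.+1 => fun a => act_path_prob (past a)
      * belief_den p (belief hp phi (past a)) (thead a) (phi (past a))
  end.

Lemma belief_den_ge0 t (pi : dist R (t.-tuple bool)) a theta :
  0 <= belief_den p pi a theta.
Proof. by apply: sumr_ge0 => m _; exact: belief_num_ge0. Qed.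

Lemma act_path_prob_ge0 t (a : t.-tuple bool) : 0 <= act_path_prob a.
Proof.
elim: t a => [|t IH] a /=; first exact: ler01.
by rewrite mulr_ge0// belief_den_ge0.
Qed.

Lemma sum_belief_den t (pi : dist R (t.-tuple bool)) theta :
  \sum_(a : bool) belief_den p pi a theta = 1.
Proof.
have [th hth] := averages_exists pi theta.
under eq_bigr do rewrite (belief_den_summary hp hth).
by rewrite -(csum_dist (summary pi)) -(sum_uact hp th)//; exact: finmeas_dist.
Qed.

(** If the denominator is zero, its nonnegative terms all vanish, so the equation survives the
    arbitrary convention. *)
Lemma belief_num_update t (pi : dist R (t.-tuple bool)) theta a m :
  belief_num p pi a theta m = belief_den p pi a theta * update hp pi a theta m.
Proof.
rewrite /= /belief_mass; case: eqP => [d0|/eqP d0]; last by rewrite mulrCA divff ?mulr1.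
rewrite d0 mul0r; apply/eqP; rewrite eq_le belief_num_ge0// andbT -d0.
by rewrite /belief_den (bigD1 m)//= lerDl sumr_ge0// => *; exact: belief_num_ge0.
Qed.

(* Bayes' rule for the state: a signal y moves the log-odds by pm y. *)
Lemma q_bayes w y n :
  q p w n * Qy p y w = (\sum_(w' : bool) q p w' n * Qy p y w') * q p w (pm y + n).
Proof.
case/andP: hp => p0 p1.
have r0 : 0 < (1 - p) / p by rewrite divr_gt0// subr_gt0; lra.
have x0 := odds_gt0 hp n.
have rN : (1 - p) / p != 0 by rewrite gt_eqF.
have e : ((1 - p) / p) ^ (pm y + n) =
    (if y then (1 - p) / p else p / (1 - p)) * ((1 - p) / p) ^ n.
  rewrite expfzDr//; congr (_ * _); case: y => /=; first by rewrite expr1z.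
  by rewrite -invr_expz expr1z invf_div.
rewrite big_bool /q e; move: (((1 - p) / p) ^ n) x0 => x x0.
have xp : 0 < x * p by rewrite mulr_gt0.
have xq : 0 < x * (1 - p) by rewrite mulr_gt0// subr_gt0; lra.
by case: w; case: y {e}; rewrite /Qy /=; field; rewrite !gt_eqF//=; lra.
Qed.

(** Chain rule: law of the actions, then messages given actions, then state given messages. The
    actions add nothing about the state beyond the messages, so [q_bayes] propagates the
    factorization. *)
Lemma path_probE w t (y a : t.-tuple bool) :
  path_prob p phi w y a = act_path_prob a * belief hp phi a y * q p w (msum y).
Proof.
elim: t y a => [|t IH] y a.
  rewrite (tuple0 y) (tuple0 a) /= /msum big_ord0 /q expr0z.
  by rewrite !mul1r; case: w.
rewrite [LHS]/= IH.
have -> : act_path_prob a * belief hp phi a y = act_path_prob (past a) *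
    belief_num p (belief hp phi (past a)) (thead a) (phi (past a)) y.
  by rewrite belief_num_update mulrA.
rewrite [in q p w (msum y)](cons_past y) msum_cons.
have -> : belief_num p (belief hp phi (past a)) (thead a) (phi (past a)) y =
    belief hp phi (past a) (past y) * phi (past a) y (thead a) *
    (\sum_(w' : bool) q p w' (msum (past y)) * Qy p (thead y) w').
  by rewrite mulr_sumr; apply: eq_bigr => w' _; ring.
move: (q_bayes w (thead y) (msum (past y))) => /= e.
transitivity (act_path_prob (past a) * (belief hp phi (past a) (past y) *
  phi (past a) y (thead a)) * (q p w (msum (past y)) * Qy p (thead y) w)); first by ring.
by rewrite e; ring.
Qed.

Lemma sum_path_prob t (a : t.-tuple bool) :
  \sum_(w : bool) \sum_(y : t.-tuple bool) path_prob p phi w y a = act_path_prob a.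
Proof.
rewrite exchange_big /=.
under eq_bigr => y _.
  under eq_bigr do rewrite path_probE.
  rewrite -mulr_sumr (_ : \sum_(w : bool) q p w (msum y) = 1) ?mulr1; last first.
    by rewrite big_bool; exact: q_sum1.
  over.
by rewrite -mulr_sumr sum_mass mulr1.
Qed.

End Paths.

(** * Supermartingale verification *)

Section Verification.
Variables (R : realType) (p delta : R) (hp : 0 < p < 2^-1) (hdelta : 0 < delta < 1).
Variable phi : policy R.
Local Notation B := (belief hp phi).
Local Notation V := (svalue hp hdelta).

Lemma tax_bound t (pi : dist R (t.-tuple bool)) theta : `|tax p pi theta| <= 4.
Proof.
have [th hth] := averages_exists pi theta; rewrite (tax_summary hp hth).
have := utax_bound hp th (finmeas_dist (summary pi)).
by rewrite csum_dist mulr1.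
Qed.

Fixpoint rewards t : t.-tuple bool -> R :=
  match t with
  | 0 => fun=> 0
  | s.+1 => fun a => rewards (past a)
      + delta ^+ s * tax p (B (past a)) (phi (past a))
  end.

(* The reward collected so far plus the discounted optimal value of the current
   summary: a supermartingale for a feasible policy, a martingale for the
   policy induced by [spolicy]. *)
Definition potential t (a : t.-tuple bool) : R :=
  rewards a + delta ^+ t * V (summary (B a)).

Definition mean_potential t : R :=
  \sum_(a : t.-tuple bool) act_path_prob hp phi a * potential a.

Lemma sum_act_path_prob t : \sum_(a : t.-tuple bool) act_path_prob hp phi a = 1.
Proof.
elim: t => [|t IH].
  by rewrite big_tuple0.
rewrite big_tupleS exchange_big /= -IH; apply: eq_bigr => a _.
under eq_bigr do rewrite past_cons theadE.
by rewrite -mulr_sumr (sum_belief_den hp) mulr1.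
Qed.

Lemma mean_potential0 : mean_potential 0 = V (summary (@point_mass R 0 [tuple])).
Proof.
by rewrite /mean_potential big_tuple0 /potential /= add0r expr0 !mul1r.
Qed.

(** Tower property: condition on the actions up to [t] and average over the next one. *)
Lemma mean_potentialS t : mean_potential t.+1 =
  \sum_(a : t.-tuple bool) act_path_prob hp phi a *
    (rewards a + delta ^+ t * (tax p (B a) (phi a) + delta *
       \sum_(a' : bool) belief_den p (B a) a' (phi a) *
          V (summary (update hp (B a) a' (phi a))))).
Proof.
rewrite /mean_potential big_tupleS exchange_big; apply: eq_bigr => a _ /=.
under eq_bigr do rewrite past_cons theadE /potential /= past_cons theadE -mulrA.
rewrite -mulr_sumr; congr (_ * _).
pose D a' := belief_den p (B a) a' (phi a).
pose v a' := V (summary (update hp (B a) a' (phi a))).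
transitivity (\sum_(a' : bool) (D a' * (rewards a + delta ^+ t * tax p (B a) (phi a))
    + delta ^+ t.+1 * (D a' * v a'))).
  by apply: eq_bigr => a' _; rewrite -/(D a') -/(v a'); ring.
rewrite big_split/= -mulr_suml (sum_belief_den hp) mul1r -mulr_sumr exprSr.
by rewrite -/D; ring.
Qed.

(** Actions of probability zero, where the two update conventions disagree, carry weight zero on
    both sides. *)
Lemma step_bellman t (pi : dist R (t.-tuple bool)) theta th : averages pi theta th ->
  tax p pi theta + delta * \sum_(a' : bool) belief_den p pi a' theta *
    V (summary (update hp pi a' theta)) = bellman hp delta V (summary pi) th.
Proof.
move=> hth; rewrite /bellman (tax_summary hp hth); congr (_ + _ * _).
apply: eq_bigr => a _; rewrite -(belief_den_summary hp hth).
have [->|d0] := eqVneq (belief_den p pi a theta) 0; first by rewrite !mul0r.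
by rewrite (summary_update hp hth).
Qed.

Lemma mean_potential_le t : feasible hp phi ->
  mean_potential t <= V (summary (@point_mass R 0 [tuple])).
Proof.
case/andP: hdelta => d0 d1.
move=> hf; elim: t => [|t IH]; first by rewrite mean_potential0.
apply: le_trans IH; rewrite mean_potentialS; apply: ler_sum => a _.
rewrite ler_wpM2l ?act_path_prob_ge0// lerD2l ler_pM2l ?exprn_gt0//.
have [th hth] := averages_exists (B a) (phi a).
rewrite (step_bellman hth); apply: bellman_le => //.
by apply/(truthful_summary hp hth); exact: hf.
Qed.

Lemma mean_potential_eq t : summary_based hp (spolicy hp hdelta) phi ->
  mean_potential t = V (summary (@point_mass R 0 [tuple])).
Proof.
move=> hs; elim: t => [|t IH]; first by rewrite mean_potential0.
rewrite -IH mean_potentialS; apply: eq_bigr => a _; congr (_ * (_ + _ * _)).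
rewrite (step_bellman (averages_summary _ (hs t a))).
by have [] := bellman_spolicy hp hdelta (summary (B a)).
Qed.

Lemma feasible_spolicy : summary_based hp (spolicy hp hdelta) phi -> feasible hp phi.
Proof.
move=> hs t a; apply/(truthful_summary hp (averages_summary _ (hs t a))).
by have [] := bellman_spolicy hp hdelta (summary (B a)).
Qed.

Lemma potential_bound t (a : t.-tuple bool) :
  `|potential a| <= 8 / (1 - delta).
Proof.
case/andP: hdelta => d0 d1.
have dt k : 0 <= delta ^+ k <= 1 by rewrite exprn_ge0 ?exprn_ile1 ?ltW.
(* The factor [1 - delta ^+ t] gives the exact geometric partial sum, as the induction requires. *)
have h : `|rewards a| <= 4 / (1 - delta) * (1 - delta ^+ t).
  elim: t a => [|t IH] a; first by rewrite /= normr0 expr0 subrr mulr0.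
  rewrite /=; apply: le_trans (ler_normD _ _) _.
  apply: le_trans (lerD (IH _) (_ : _ <= delta ^+ t * 4)) _.
    rewrite normrM ger0_norm; last by have /andP[] := dt t.
    by rewrite ler_wpM2l ?tax_bound//; have /andP[] := dt t.
  rewrite exprS -subr_ge0; set X := (X in 0 <= X); suff -> : X = 0 by [].
  by rewrite /X; field; lra.
have c0 : 0 <= 4 / (1 - delta) by rewrite divr_ge0//; lra.
have /andP[e0 e1] := dt t.
apply: le_trans (ler_normD _ _) _.
have h1 : `|rewards a| <= 4 / (1 - delta).
  by apply: le_trans h _; rewrite ler_piMr// gerBl.
have h2 : `|delta ^+ t * V (summary (B a))| <= 4 / (1 - delta).
  rewrite normrM (ger0_norm e0) -[leRHS]mul1r ler_pM//.
  exact: svalue_bound.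
apply: le_trans (lerD h1 h2) _; rewrite -mulrDl; lra.
Qed.

Lemma rewards_hist (T : Type) (X : nat -> T -> bool) t omega :
  series (fun k => delta ^+ k * tax p (B (hist X k omega)) (phi (hist X k omega))) t
  = rewards (hist X t omega).
Proof.
elim: t => [|t IH]; first by rewrite /series /= big_geq.
by rewrite seriesSr IH /= past_cons.
Qed.

(** * Expected payoff on a realizing probability space *)

Section Expectation.
Context d (Omega : measurableType d) (P : probability Omega R).
Variables (W : {mfun Omega >-> bool}) (Y A : nat -> {mfun Omega >-> bool}).
Hypothesis hreal : realizes p phi P W Y A.

Lemma measurable_hist (X : nat -> {mfun Omega >-> bool}) t (a : t.-tuple bool) :
  measurable [set omega | hist X t omega = a].
Proof.
elim: t a => [|t IH] a.
  rewrite (_ : [set _ | _] = setT)//; apply/seteqP; split=> // x _ /=.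
  by rewrite (tuple0 a).
rewrite (_ : [set _ | _] = (X t @^-1` [set thead a]) `&`
    [set omega | hist X t omega = past a]).
  apply: measurableI => //.
  by rewrite -[_ @^-1` _]setTI; exact: measurable_funP.
apply/seteqP; split=> x /=.
  by move=> <-; rewrite theadE past_cons.
by case=> -> ->; rewrite -cons_past.
Qed.

Lemma measure_fibers (T : finType) (f : Omega -> T) (S : set Omega) :
  measurable S -> (forall i, measurable [set omega | f omega = i]) ->
  P S = (\sum_(i : T) P (S `&` [set omega | f omega = i]))%E.
Proof.
move=> mS mf.
rewrite {1}(_ : S = \bigcup_(i in [set` index_enum T])
    (S `&` [set omega | f omega = i])).
  rewrite measure_fin_bigcup//.
  - by rewrite -fsbig_seq// index_enum_uniq.
  - apply/trivIsetP => i j _ _ /eqP ij; apply/seteqP; split=> // x [[_ xi] [_ xj]].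
    by case: ij; rewrite -xi -xj.
  - by move=> i _; exact: measurableI.
apply/seteqP; split=> [x Sx|x [i _ []]//].
by exists (f x) => //=; rewrite mem_index_enum.
Qed.

(** The joint law fixed by [realizes] is summed over the state and the signals. *)
Lemma prob_hist t (a : t.-tuple bool) :
  P [set omega | hist A t omega = a] = (act_path_prob hp phi a)%:E.
Proof.
have mW i : measurable [set omega | W omega = i].
  by rewrite (_ : [set _ | _] = setT `&` W @^-1` [set i]) ?setTI//;
    rewrite -[_ @^-1` _]setTI; exact: measurable_funP.
rewrite (measure_fibers (measurable_hist A a) mW) -sum_path_prob -sumEFin.
apply: eq_bigr => w _.
rewrite (measure_fibers (measurableI _ _ (measurable_hist A a) (mW w))
  (@measurable_hist Y t)).
rewrite -sumEFin; apply: eq_bigr => y _; rewrite -hreal; congr (P _).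
by apply/seteqP; split=> x /=; [move=> [[]]|move=> []].
Qed.

Lemma measurable_fun_hist t (g : t.-tuple bool -> R) :
  measurable_fun [set: Omega] (fun omega => g (hist A t omega)).
Proof.
move=> _ S mS; rewrite setTI.
rewrite (_ : _ @^-1` _ =
    \bigcup_(a in [set a | S (g a)]) [set omega | hist A t omega = a]).
  by apply: fin_bigcup_measurable => // a _; exact: measurable_hist.
apply/seteqP; split=> [x Sx|x [a Sa /= xa]]; last by rewrite /preimage/= xa.
by exists (hist A t x).
Qed.

Lemma expectation_hist t (g : t.-tuple bool -> R) :
  ('E_P[fun omega => g (hist A t omega)] =
   (\sum_(a : t.-tuple bool) act_path_prob hp phi a * g a)%:E)%E.
Proof.
rewrite unlock -sumEFin.
pose F a := [set omega | hist A t omega = a].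
have UE : [set: Omega] = \big[setU/set0]_(a <- index_enum (t.-tuple bool)) F a.
  rewrite -bigcup_seq; apply/seteqP; split=> // x _.
  by exists (hist A t x) => //=; rewrite mem_index_enum.
rewrite UE integral_bigsetU_EFin//=; last 4 first.
- by move=> a; exact: measurable_hist.
- exact: index_enum_uniq.
- apply/trivIsetP => i j _ _ /eqP ij; apply/seteqP; split=> // x [xi xj].
  by case: ij; rewrite -xi -xj.
- by rewrite -UE; apply/measurable_EFinP; exact: measurable_fun_hist.
apply: eq_bigr => a _.
rewrite (eq_integral (cst (g a)%:E)); last by move=> x; rewrite inE /F /= => ->.
rewrite integral_cst; last exact: measurable_hist.
transitivity ((g a)%:E * (act_path_prob hp phi a)%:E)%E; last by rewrite -EFinM mulrC.
by congr (_ * _)%E; exact: prob_hist.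
Qed.

Lemma cvg_rewards omega :
  rewards (hist A t omega) @[t --> \oo] --> payoff delta hp phi A omega /\
  forall t, `|payoff delta hp phi A omega - rewards (hist A t omega)|
    <= 4 / (1 - delta) * delta ^+ t.
Proof.
case/andP: hdelta => d0 d1.
set r := fun k => delta ^+ k * tax p (B (hist A k omega)) (phi (hist A k omega)).
have hr k : `|series r k.+1 - series r k| <= 4 * delta ^+ k.
  have dk : 0 <= delta ^+ k by rewrite exprn_ge0 ?ltW.
  rewrite seriesSr addrAC subrr add0r /r normrM ger0_norm// mulrC.
  by rewrite ler_wpM2r ?tax_bound.
have r0 : series r 0 = 0 by rewrite /series /= big_geq.
have [cr hl] := cvg_lim_geometric hdelta r0 hr.
split=> [|t]; last by rewrite -rewards_hist; exact: hl.
by under eq_fun do rewrite -rewards_hist.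
Qed.

(** Future rewards and the discounted value are each at most [4 / (1 - delta) * delta ^+ t], whence
    the constant 8. *)
Lemma payoff_approx t omega :
  `|payoff delta hp phi A omega - potential (hist A t omega)|
    <= 8 / (1 - delta) * delta ^+ t.
Proof.
case/andP: hdelta => d0 d1.
have [_ /(_ t) h] := cvg_rewards omega.
rewrite /potential opprD addrA; apply: le_trans (ler_normB _ _) _.
apply: le_trans (lerD h (_ : _ <= 4 / (1 - delta) * delta ^+ t)) _.
  have dt : 0 <= delta ^+ t by rewrite exprn_ge0 ?ltW.
  by rewrite normrM ger0_norm// mulrC ler_wpM2r// svalue_bound.
by rewrite -!mulrDl -natrD.
Qed.

Lemma measurable_payoff : measurable_fun [set: Omega] (payoff delta hp phi A).
Proof.
apply: (@measurable_fun_cvg _ _ _ _ (fun t omega => rewards (hist A t omega))).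
  by move=> t; exact: measurable_fun_hist.
by move=> omega _; have [] := cvg_rewards omega.
Qed.

Let integrable_bounded (f : Omega -> R) M : measurable_fun [set: Omega] f ->
  (forall x, `|f x| <= M) -> P.-integrable setT (EFin \o f).
Proof.
move=> mf hM; apply: measurable_bounded_integrable => //.
  by apply: le_lt_trans (probability_le1 P measurableT) _; rewrite ltry.
exists M; split; rewrite ?num_real// => x Mx y _ /=.
exact: le_trans (hM y) (ltW Mx).
Qed.

Lemma expectation_payoff t :
  ('E_P[payoff delta hp phi A]
     <= (mean_potential t + 8 / (1 - delta) * delta ^+ t)%:E)%E
  /\ ((mean_potential t - 8 / (1 - delta) * delta ^+ t)%:E
     <= 'E_P[payoff delta hp phi A])%E.
Proof.
set e := 8 / (1 - delta) * delta ^+ t.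
(* The error constant goes inside the expectation, as the histories have total probability 1; a
   pointwise comparison of integrands then suffices. *)
have shift c : (mean_potential t + c)%:E =
    'E_P[fun omega => (potential (hist A t omega) + c)%R]%E.
  rewrite (expectation_hist (fun a => potential a + c)); congr EFin.
  under [RHS]eq_bigr do rewrite mulrDr.
  by rewrite big_split/= -mulr_suml sum_act_path_prob mul1r.
have ip c : P.-integrable setT (EFin \o (fun omega => potential (hist A t omega) + c)).
  apply: (@integrable_bounded _ (8 / (1 - delta) + `|c|)).
    exact: (measurable_fun_hist (fun a => potential a + c)).
  by move=> x; apply: le_trans (ler_normD _ _) _; rewrite lerD2r potential_bound.
have ipay : P.-integrable setT (EFin \o payoff delta hp phi A).
  apply: (@integrable_bounded _ (8 / (1 - delta) + e)) => [|x].
    exact: measurable_payoff.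
  rewrite -[payoff _ _ _ _ _](subrK (potential (hist A t x))) addrC.
  apply: le_trans (ler_normD _ _) _; apply: lerD; first exact: potential_bound.
  exact: payoff_approx.
have ap x := payoff_approx t x.
by split; rewrite shift unlock;
  [apply: (le_integral _ ipay (ip _))|apply: (le_integral _ (ip _) ipay)] => // x _;
  rewrite lee_fin;
  have := ap x; rewrite -/e ler_distl => /andP[].
Qed.

End Expectation.
End Verification.

(** * The policy induced by a stationary summary-based strategy *)

Section InducedPolicy.
Variables (R : realType) (p : R) (hp : 0 < p < 2^-1) (phi0 : dist R int -> sstrat R).

Definition induced_strat t (pi : dist R (t.-tuple bool)) : strat R t :=
  fun m => phi0 (summary pi) (msum (past m)) (thead m).

(** Policy and belief determine each other; computing the belief directly from [phi0] first breaks
    the circularity. *)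
Fixpoint induced_belief t : t.-tuple bool -> dist R (t.-tuple bool) :=
  match t with
  | 0 => fun=> @point_mass R 0 [tuple]
  | s.+1 => fun a => let pi := induced_belief (past a) in
      update hp pi (thead a) (induced_strat pi)
  end.

Definition induced_policy : policy R := fun t a => induced_strat (induced_belief a).

Lemma belief_induced t (a : t.-tuple bool) :
  belief hp induced_policy a = induced_belief a.
Proof. by elim: t a => [//|t IH] a /=; rewrite IH. Qed.

Lemma summary_based_induced : summary_based hp phi0 induced_policy.
Proof. by move=> t a m; rewrite belief_induced. Qed.

End InducedPolicy.

Theorem theorem3 (R : realType) (p delta : R) (hp : 0 < p < 2^-1)
    (hdelta : 0 < delta < 1) :
  exists (phi0 : dist R int -> sstrat R) (V : dist R int -> R),
    [/\ exists2 phi : policy R,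
          summary_based hp phi0 phi & optimal delta hp phi,
        exists M : R, forall eta, `|V eta| <= M,
        forall eta, is_max (struthful p eta) (bellman hp delta V eta) (V eta)
      & forall eta, argmax (struthful p eta) (bellman hp delta V eta)
                      (phi0 eta)].
Proof.
exists (spolicy hp hdelta), (svalue hp hdelta); split.
- pose phi := induced_policy hp (spolicy hp hdelta).
  have hs : summary_based hp (spolicy hp hdelta) phi := summary_based_induced _ _.
  exists phi => //; split; first exact: feasible_spolicy hs.
  move=> phi' hf d Omega P W Y A d' Omega' P' W' Y' A' hr hr'.
  apply/lee_addgt0Pr => e e0.
  have e2 : 0 < e / 2 by rewrite divr_gt0.
  (* Both expected payoffs are compared with the value at the initial summary belief, each up to
     [e / 2]. *)
  have [t ht] := geometric_small (8 / (1 - delta)) hdelta e2.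
  have [h' _] := expectation_payoff hp hdelta hr' t.
  have [_ h] := expectation_payoff hp hdelta hr t.
  rewrite (mean_potential_eq _ hs) in h.
  have hle := mean_potential_le hdelta t hf.
  apply: le_trans h' _; apply: le_trans (leeD2r _ h).
  by rewrite -EFinD lee_fin; lra.
- by exists (4 / (1 - delta)) => eta; exact: svalue_bound.
- move=> eta; split; last by move=> th; exact: bellman_le.
  by exists (spolicy hp hdelta eta); have [] := bellman_spolicy hp hdelta eta.
- move=> eta; have [h e] := bellman_spolicy hp hdelta eta.
  apply: conj; first exact: h.
  by move=> th hth; rewrite [leRHS]e; exact: bellman_le hth.
Qed.
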